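(* Let $q_1,q_2$ be integers with $1\le q_1\le q_2$, $A=\begin{pmatrix}3q_1&0\\0&3q_2\end{pmatrix}$, $\mathcal{D}=\left\{\begin{pmatrix}0\\0\end{pmatrix},\begin{pmatrix}1\\0\end{pmatrix},\begin{pmatrix}0\\1\end{pmatrix}\right\}$, and $\mu_{A,\mathcal{D}}$ the associated Sierpiński-type measure. For any orthogonal set $\Lambda$ of $\mu_{A,\mathcal{D}}$ we have $\dim_{Be}(\Lambda)\le\frac{\log 3}{\log 3q_2}$. Moreover, if $\Lambda$ is a spectrum of $\mu_{A,\mathcal{D}}$ and there exists an integer $p\ge1$ such that $$\sup_{\lambda\in\Lambda}\inf_{\gamma\in\Lambda}\|A^{-p}\lambda-\gamma\|<+\infty,$$ then $\dim_{Be}(\Lambda)=\frac{\log 3}{\log 3q_2}$.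
   Context: $\mu_{A,\mathcal{D}}$ is the unique Borel probability measure on $\mathbb{R}^2$ with $\mu_{A,\mathcal{D}}(E)=\frac13\sum_{d\in\mathcal{D}}\mu_{A,\mathcal{D}}(AE-d)$ for Borel $E$. A countable $\Lambda\subseteq\mathbb{R}^2$ is an orthogonal set of $\mu$ if $\{e^{-2\pi i\langle\lambda,x\rangle}:\lambda\in\Lambda\}$ is an orthogonal family in $L^2(\mu)$, and a spectrum if it is an orthonormal basis of $L^2(\mu)$. For a countable $\Lambda\subseteq\mathbb{R}^d$ and $r>0$, $D_r^+(\Lambda)=\limsup_{h\to\infty}\sup_{x\in\mathbb{R}^d}\#(\Lambda\cap B(x,h))/h^r$, where $B(x,h)$ is the open ball of radius $h$ about $x$; the (upper) Beurling dimension is $\dim_{Be}(\Lambda)=\inf\{r:D_r^+(\Lambda)=0\}=\sup\{r:D_r^+(\Lambda)=\infty\}$. *)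

(* Defs.v *)
(* R : realType, the plane is (R * R) with the
   product sigma-algebra of the Borel sigma-algebras (= Borel sets of R^2). *)
From HB Require Import structures.
From mathcomp Require Import all_boot all_order all_algebra.
From mathcomp Require Import finmap.
From mathcomp Require Import all_classical all_reals all_analysis.
Set Implicit Arguments. Unset Strict Implicit. Unset Printing Implicit Defensive.
Import Order.TTheory GRing.Theory Num.Theory.
Import numFieldNormedType.Exports.
Local Open Scope classical_set_scope.
Local Open Scope ring_scope.

Section Defs.
Variable R : realType.
Notation P2 := (R * R)%type.

Definition dot2 (u v : P2) : R := u.1 * v.1 + u.2 * v.2.
Definition norm2 (u : P2) : R := Num.sqrt (u.1 ^+ 2 + u.2 ^+ 2).
Definition ball2 (x : P2) (h : R) : set P2 := [set y | norm2 (y.1 - x.1, y.2 - x.2) < h].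

Definition matA (q1 q2 : nat) (x : P2) : P2 := (3 * q1%:R * x.1, 3 * q2%:R * x.2).
Definition digits : seq P2 := [:: (0, 0); (1, 0); (0, 1)].

Definition sierpinski_invariant (q1 q2 : nat)
    (mu : probability P2 R) : Prop :=
  forall E : set P2, measurable E ->
    (mu E = ((3 : R)^-1)%:E *
      \sum_(d <- digits) mu [set ((matA q1 q2 x).1 - d.1, (matA q1 q2 x).2 - d.2)%R | x in E])%E.

(* real and imaginary parts of e^{-2 pi i <xi, x>} *)
Definition ecos (xi x : P2) : R := cos (2 * pi * dot2 xi x).
Definition esin (xi x : P2) : R := - sin (2 * pi * dot2 xi x).

(* {e_lambda} orthogonal in L^2(mu): for lambda <> lambda',
   int e_lambda * conj(e_lambda') dmu = int e^{-2 pi i <lambda - lambda', x>} dmu = 0,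
   written via real and imaginary parts. *)
Definition orthogonal_set (mu : probability P2 R) (L : set P2) : Prop :=
  countable L /\
  forall l l', L l -> L l' -> l <> l' ->
    (\int[mu]_x (ecos (l.1 - l'.1, l.2 - l'.2) x)%:E = 0)%E /\
    (\int[mu]_x (esin (l.1 - l'.1, l.2 - l'.2) x)%:E = 0)%E.

(* Spectrum: {e_lambda} is an orthonormal basis of (complex) L^2(mu).
   Norms are automatically 1 since mu is a probability measure; completeness:
   any f = u + i v in L^2(mu) with <f, e_lambda> = int f * conj(e_lambda) dmu = 0
   for every lambda in L vanishes mu-a.e.  Here conj(e_lambda)(x) = ecos - i esin. *)
Definition spectrum (mu : probability P2 R) (L : set P2) : Prop :=
  orthogonal_set mu L /\
  forall u v : P2 -> R, measurable_fun setT u -> measurable_fun setT v ->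
    (\int[mu]_x ((u x) ^+ 2)%:E < +oo)%E ->
    (\int[mu]_x ((v x) ^+ 2)%:E < +oo)%E ->
    (forall l, L l ->
       (\int[mu]_x (u x * ecos l x + v x * esin l x)%:E = 0)%E /\
       (\int[mu]_x (v x * ecos l x - u x * esin l x)%:E = 0)%E) ->
    {ae mu, forall x, u x = 0 /\ v x = 0}.

Definition card_e (S : set P2) : \bar R :=
  if `[< finite_set S >] then ((#|` fset_set S|)%fset%:R)%:E else +oo%E.

(* D_r^+(L) = limsup_{h -> oo} sup_x #(L ∩ B(x,h)) / h^r, with
   limsup_{h->oo} F h := inf_M sup_{h > M} F h *)
Definition upper_density (r : R) (L : set P2) : \bar R :=
  ereal_inf [set ereal_sup [set ereal_sup
      [set (card_e (L `&` ball2 x h) * ((h `^ r)^-1)%:E)%E | x in [set: P2]]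
    | h in [set h | M < h]] | M in [set: R]].

Definition beurling_dim (L : set P2) : \bar R :=
  ereal_inf [set r%:E | r in [set r | 0 < r /\ upper_density r L = 0%E]].

Definition matA_invpow (q1 q2 p : nat) (x : P2) : P2 :=
  (x.1 / (3 * q1%:R) ^+ p, x.2 / (3 * q2%:R) ^+ p).

End Defs.

(* Main.v *)
Require Import Defs.
From mathcomp Require Import all_boot all_order all_algebra.
From mathcomp Require Import finmap lra ring.
From mathcomp Require Import all_classical all_reals all_analysis measurable_realfun.
Set Implicit Arguments. Unset Strict Implicit. Unset Printing Implicit Defensive.
Import Order.TTheory GRing.Theory Num.Theory.
Import numFieldNormedType.Exports.
Local Open Scope classical_set_scope.
Local Open Scope ring_scope.

(** Upper bound.  The Fourier transform of mu vanishes at xi only if some A^-j xi,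
    j >= 1, is a zero of the mask (1 + e(x_1) + e(x_2)) / 3, so differences of
    points of an orthogonal set have the form A^j (k_1, k_2) / 3 with 3 not dividing
    k_1 and k_2 <> 0.  In a ball of radius h the second coordinate forces
    (3 q_2)^j < 6 h, and a pigeonhole on the first coordinate modulo 3 q_1, 9 q_1, ...
    leaves at most 3^n points when only the levels j <= n occur.

    Lower bound.  Parseval applied to the indicator of the cylinder A^-N Q, which
    has measure 3^-N, gives the identity: the sum over l in L of |mu^(A^-N l)|^2 is
    3^N.  Iterating the hypothesis, A^-N l stays within a bounded distance of some
    point tau(l) of L when p divides N.  Expanding e(<A^-N l - tau(l), x>) in a Taylor
    series and applying Bessel's inequality to every monomial bounds the same sum by a
    constant times the largest fibre of tau, and each fibre lies in a ball of radius
    O((3 q_2)^N).  Hence some such ball contains at least c 3^N points of L. *)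

(** [spectrum] states completeness as a uniqueness property: only zero is orthogonal to all
    exponentials. Parseval needs the L^2 limit of the partial Fourier sums as an actual function to
    which this property can be applied, hence the detour through Riesz-Fischer. Bessel's inequality
    concerns one function and distinct frequencies. The lower bound offers neither: the displacement
    A^-N l - tau(l) changes with l, and tau may repeat values. Taylor expansion moves the dependence
    on l into coefficients, bounded uniformly by weights of finite total e^(4 pi C), so that only
    fixed monomials meet Bessel; repetition costs the size of a fibre. The resulting constant does
    not depend on N. This makes the exponent sharp: in both halves the scale (3 q_2)^N is matched
    with the count 3^N. *)

(** * Completeness of L^2 *)

Section RieszFischer.
Context d (T : measurableType d) (R : realType) (mu : probability T R).

(* Cauchy-Schwarz against 1, in AM-GM form. *)
Lemma integral_abs_le (f : T -> R) (s : R) : measurable_fun setT f -> 0 < s ->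
  (\int[mu]_x ((f x) ^+ 2)%:E <= (s ^+ 2)%:E)%E ->
  (\int[mu]_x `|f x|%:E <= s%:E)%E.
Proof.
move=> mf s0 fs.
have mf2 : measurable_fun setT (EFin \o (fun x => (f x) ^+ 2)).
  by apply/measurable_EFinP; exact: measurable_funX.
apply: (@le_trans _ _ (\int[mu]_x ((s / 2)%:E + (s^-1 / 2)%:E * ((f x) ^+ 2)%:E))%E).
  apply: ge0_le_integral => //.
  - by apply/measurable_EFinP; exact: measurableT_comp.
  - apply: emeasurable_funD => //; exact: measurable_funeM.
  - move=> x _; rewrite -EFinM -EFinD lee_fin.
    have -> : s / 2 + s^-1 / 2 * f x ^+ 2 = `|f x| + s^-1 / 2 * (`|f x| - s) ^+ 2.
      by rewrite -(real_normK (num_real (f x))); field; rewrite gt_eqF.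
    by rewrite lerDl mulr_ge0 ?sqr_ge0// divr_ge0// invr_ge0 ltW.
rewrite ge0_integralD//; last 3 first.
- by move=> x _; rewrite lee_fin divr_ge0// ltW.
- by move=> x _; rewrite -EFinM lee_fin mulr_ge0 ?sqr_ge0// divr_ge0// invr_ge0 ltW.
- exact: measurable_funeM.
rewrite integral_cst// ge0_integralZl//; last 2 first.
- by move=> x _; rewrite lee_fin sqr_ge0.
- by rewrite lee_fin divr_ge0// invr_ge0 ltW.
rewrite [X in (_ * X + _)%E](_ : _ = 1%E) ?mule1; last exact: probability_setT.
apply: (@le_trans _ _ ((s / 2)%:E + (s^-1 / 2)%:E * (s ^+ 2)%:E)%E).
  by rewrite leeD2l// lee_pmul2l// ?lte_fin ?divr_gt0// invr_gt0.
by rewrite -EFinM -EFinD lee_fin le_eqVlt; apply/orP; left; apply/eqP; field; rewrite gt_eqF.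
Qed.

(** Partial sums of [(N i).+1] serve as [k j]: they dominate both [N j] and [j] and are monotone
    whatever [N] is. The tolerance is squared because [t] will bound squared L^2 distances, while
    the increments are to be summed in L^1. *)
Lemma subseq_geometric (t : nat -> R) : t @ \oo --> 0 ->
  exists k : nat -> nat, [/\ {homo k : i j / (i <= j)%N}, forall j, (j <= k j)%N &
    forall j, t (k j) <= (2^-1 ^+ j) ^+ 2].
Proof.
move=> t0.
have ex j : exists N, forall n, (N <= n)%N -> t n <= (2^-1 ^+ j) ^+ 2.
  have := t0; move=> /cvgrPdist_le/(_ ((2^-1 ^+ j) ^+ 2)).
  have e0 : 0 < ((2^-1 : R) ^+ j) ^+ 2 by rewrite !exprn_gt0//; lra.
  move=> /(_ e0)[N _ hN]; exists N => n /hN /=.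
  by rewrite sub0r normrN; apply: le_trans; exact: ler_norm.
have [N hN] := choice ex.
exists (fun j => \sum_(i < j.+1) (N i).+1)%N; split.
- move=> i j ij; rewrite -(subnKC ij) -addSn big_split_ord /=; exact: leq_addr.
- elim=> [//|j IH]; rewrite big_ord_recr /= addnS ltnS.
  by apply: (leq_trans IH); exact: leq_addr.
- move=> j; apply: hN; rewrite big_ord_recr /= addnS.
  by apply: leqW; exact: leq_addl.
Qed.

(** Along the subsequence the increments have summable L^1 norms, so their series converges
    absolutely almost everywhere; Fatou then transfers the Cauchy bound [t n] unchanged to the
    limit. *)
Lemma riesz_fischer (U : nat -> T -> R) (t : nat -> R) :
  (forall n, measurable_fun setT (U n)) -> t @ \oo --> 0 ->
  (forall m n, (n <= m)%N ->
    (\int[mu]_x ((U m x - U n x) ^+ 2)%:E <= (t n)%:E)%E) ->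
  exists2 V : T -> R, measurable_fun setT V &
    forall n, (\int[mu]_x ((U n x - V x) ^+ 2)%:E <= (t n)%:E)%E.
Proof.
move=> mU t0 Ut; have [k [kmono kge kt]] := subseq_geometric t0.
pose D j x := U (k j.+1) x - U (k j) x.
have mD j : measurable_fun setT (D j) by exact: measurable_funB.
have mnD j : measurable_fun setT (EFin \o (fun x => `|D j x|)).
  by apply/measurable_EFinP; exact: measurableT_comp.
have intD j : (\int[mu]_x `|D j x|%:E <= (2^-1 ^+ j)%:E)%E.
  have h0 : 0 < (2^-1 : R) ^+ j by rewrite exprn_gt0//; lra.
  apply: (integral_abs_le (mD j) h0).
  by apply: le_trans (Ut _ _ (kmono _ _ (leqnSn j))) _; rewrite lee_fin.
have intS : (\int[mu]_x (\sum_(j <oo) `|D j x|%:E) < +oo)%E.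
  rewrite integral_nneseries//.
  apply: (@le_lt_trans _ _ (\sum_(j <oo) (2^-1 ^+ j)%:E)%E).
    by apply: lee_nneseries => *; first [exact: intD | exact: integral_ge0].
  apply: (@le_lt_trans _ _ (2%:E)); last by rewrite ltry.
  apply: lime_le.
    by apply: is_cvg_nneseries => j _ _; rewrite lee_fin exprn_ge0//; lra.
  apply: nearW => n; rewrite sumEFin lee_fin.
  have := @geometric_le_lim R n 1 2^-1.
  rewrite (_ : 1 * (1 - 2^-1)^-1 = 2 :> R); last by field.
  rewrite /series /geometric /= => h; under eq_bigr do rewrite -(mul1r (_ ^+ _)).
  by apply: h; rewrite // ?ger0_norm; lra.
have Sint : mu.-integrable setT (fun x => \sum_(j <oo) `|D j x|%:E)%E.
  apply/integrableP; split.
    by apply: ge0_emeasurable_sum => *; rewrite ?lee_fin//; exact: mnD.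
  under eq_integral => x _.
    rewrite gee0_abs; last by apply: nneseries_ge0 => *; rewrite lee_fin.
    over.
  by [].
(* The upper limit is measurable and defined everywhere; it is the limit wherever the subsequence
   converges. *)
pose W x := limn_esup (fun j => (U (k j) x)%:E).
have mW : measurable_fun setT W.
  by apply: measurable_fun_limn_esup => j; exact/measurable_EFinP.
pose V x := fine (W x).
have mV : measurable_fun setT V by apply: measurableT_comp => //; exact: measurable_fine.
have aecvg : {ae mu, forall x, (fun j => U (k j) x) @ \oo --> V x}.
  apply: filterS (integrable_ae measurableT Sint) => x /(_ I) fin.
  have : cvgn [normed series (fun j => D j x)].
    rewrite /normed_series_of /=.
    apply: nondecreasing_is_cvgn.
      by apply: nondecreasing_series => *.
    exists (fine (\sum_(j <oo) `|D j x|%:E)%E) => _ [n _ <-].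
    rewrite -lee_fin fineK// /series /= -sumEFin.
    apply: nneseries_lim_ge => *; by rewrite lee_fin.
  move/normed_cvg => cD.
  have cU : cvgn (fun j => U (k j) x).
    have -> : (fun j => U (k j) x) = (fun j => U (k 0%N) x + series (fun j => D j x) j).
      apply/funext => j; rewrite /series /=.
      by rewrite /D (telescope_sumr (fun j => U (k j) x))// addrC subrK.
    by apply: is_cvgD => //; exact: is_cvg_cst.
  have cE : (fun j => (U (k j) x)%:E) @ \oo --> (limn (fun j => U (k j) x))%:E.
    by apply: cvg_EFin => //; exact: nearW.
  by rewrite /V /W (cvg_limn_einf_sup cE).2 /=.
exists V => // n.
have msq (f g : T -> R) : measurable_fun setT f -> measurable_fun setT g ->
    measurable_fun setT (EFin \o (fun x => (f x - g x) ^+ 2)).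
  move=> mf mg; apply/measurable_EFinP; apply: measurable_funX.
  exact: measurable_funB.
apply: (@le_trans _ _ (\int[mu]_x limn_einf (fun j => ((U (k j) x - U n x) ^+ 2)%:E))%E).
  apply: ae_ge0_le_integral => //.
  - by move=> *; rewrite lee_fin sqr_ge0.
  - exact: msq.
  - move=> x _; rewrite limn_einf_lim; apply: lime_ge; first exact: is_cvg_einfs.
    apply: nearW => m; apply: le_ereal_inf_tmp => _ [j _ <-].
    by rewrite lee_fin sqr_ge0.
  - rewrite /limn_einf; apply: measurableT_comp => //.
    apply: (measurable_fun_limn_esup (f := fun j x => (- ((U (k j) x - U n x) ^+ 2)%:E)%E)) => j.
    apply: measurableT_comp => //; exact: msq.
  - apply: filterS aecvg => x cx _.
    have cE : (fun j => ((U (k j) x - U n x) ^+ 2)%:E) @ \oo --> ((V x - U n x) ^+ 2)%:E.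
      apply: cvg_EFin; first exact: nearW.
      have -> : fine \o (fun j => ((U (k j) x - U n x) ^+ 2)%:E) =
          (fun j => (U (k j) x - U n x) * (U (k j) x - U n x)).
        by apply/funext => j /=; rewrite expr2.
      by rewrite expr2; apply: cvgM; apply: cvgB => //; exact: cvg_cst.
    by rewrite (cvg_limn_einf_sup cE).1 lee_fin -sqrrN opprB.
apply: le_trans (fatou _ _ _ _) _ => //.
- by move=> j; exact: msq.
- by move=> *; rewrite lee_fin sqr_ge0.
rewrite limn_einf_lim; apply: lime_le; first exact: is_cvg_einfs.
near=> m; apply: (@le_trans _ _ (\int[mu]_x ((U (k m) x - U n x) ^+ 2)%:E)%E).
  by apply: ereal_inf_lbound; exists m => /=.
apply: Ut; apply: leq_trans (kge m); near: m; exact: nbhs_infty_ge.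
Unshelve. all: by end_near. Qed.

End RieszFischer.

(** * Bounded measurable functions and their real integrals *)

Section BoundedFunctions.
Context d (T : measurableType d) (R : realType) (mu : probability T R).
Implicit Types f g : T -> R.

(** This class is closed under sums and products and integrable for a probability measure, so its
    integrals can be computed with as real numbers. *)
Definition bmeas f := measurable_fun setT f /\ exists M : R, forall x, `|f x| <= M.

Lemma bmeas_integrable f : bmeas f -> mu.-integrable setT (EFin \o f).
Proof.
move=> [mf [M fM]]; apply: measurable_bounded_integrable => //.
  by apply: (@le_lt_trans _ _ 1%E); [exact: probability_le1|exact: ltry].
exists M; split; first exact: num_real.
by move=> N MN x _ /=; apply: le_trans (fM x) _; exact: ltW.
Qed.

Lemma bmeas_cst (r : R) : bmeas (fun=> r).
Proof. by split=> //; exists `|r|. Qed.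

Lemma bmeasD f g : bmeas f -> bmeas g -> bmeas (fun x => f x + g x).
Proof.
move=> [mf [M fM]] [mg [N gN]]; split; first exact: measurable_funD.
by exists (M + N) => x; apply: le_trans (ler_normD _ _) _; exact: lerD.
Qed.

Lemma bmeasN f : bmeas f -> bmeas (fun x => - f x).
Proof.
by move=> [mf [M fM]]; split; [exact: measurableT_comp|exists M => x; rewrite normrN].
Qed.

Lemma bmeasB f g : bmeas f -> bmeas g -> bmeas (fun x => f x - g x).
Proof. by move=> bf bg; apply: bmeasD => //; exact: bmeasN. Qed.

Lemma bmeasM f g : bmeas f -> bmeas g -> bmeas (fun x => f x * g x).
Proof.
move=> [mf [M fM]] [mg [N gN]]; split; first exact: measurable_funM.
by exists (M * N) => x; rewrite normrM; exact: ler_pM.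
Qed.

Lemma bmeasX f n : bmeas f -> bmeas (fun x => f x ^+ n).
Proof.
move=> bf; elim: n => [|n IH]; first exact: bmeas_cst.
by under eq_fun do rewrite exprS; exact: bmeasM.
Qed.

Lemma bmeas_sum I (s : seq I) (F : I -> T -> R) :
  (forall i, bmeas (F i)) -> bmeas (fun x => \sum_(i <- s) F i x).
Proof.
move=> bF; elim: s => [|i s IH].
  by under eq_fun do rewrite big_nil; exact: bmeas_cst.
by under eq_fun do rewrite big_cons; exact: bmeasD.
Qed.

Lemma Rintegral_EFin f : bmeas f ->
  (\int[mu]_x (f x)%:E)%E = (\int[mu]_x f x)%:E.
Proof.
by move=> /bmeas_integrable bf; rewrite /Rintegral fineK//; exact: integrable_fin_num.
Qed.

Lemma RintD f g : bmeas f -> bmeas g ->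
  \int[mu]_x (f x + g x) = \int[mu]_x f x + \int[mu]_x g x.
Proof. by move=> bf bg; apply: RintegralD => //; exact: bmeas_integrable. Qed.

Lemma RintB f g : bmeas f -> bmeas g ->
  \int[mu]_x (f x - g x) = \int[mu]_x f x - \int[mu]_x g x.
Proof. by move=> bf bg; apply: RintegralB => //; exact: bmeas_integrable. Qed.

Lemma RintZl r f : bmeas f -> \int[mu]_x (r * f x) = r * \int[mu]_x f x.
Proof. by move=> bf; apply: RintegralZl => //; exact: bmeas_integrable. Qed.

Lemma RintN f : bmeas f -> \int[mu]_x (- f x) = - \int[mu]_x f x.
Proof.
move=> bf; rewrite -mulN1r -RintZl//; apply: eq_Rintegral => x _.
by rewrite mulN1r.
Qed.

Lemma Rint_cst r : \int[mu]_x r = r.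
Proof.
rewrite Rintegral_cst// [X in fine X](_ : _ = 1%E) ?mulr1//.
exact: probability_setT.
Qed.

Lemma Rint_sum I (s : seq I) (F : I -> T -> R) : (forall i, bmeas (F i)) ->
  \int[mu]_x (\sum_(i <- s) F i x) = \sum_(i <- s) \int[mu]_x F i x.
Proof.
move=> bF; elim: s => [|i s IH].
  rewrite big_nil -[RHS](Rint_cst 0); apply: eq_Rintegral => x _.
  by rewrite big_nil.
rewrite big_cons -IH -RintD//; last exact: bmeas_sum.
by apply: eq_Rintegral => x _; rewrite big_cons.
Qed.

Lemma Rint_le f g : bmeas f -> bmeas g -> (forall x, f x <= g x) ->
  \int[mu]_x f x <= \int[mu]_x g x.
Proof. by move=> bf bg fg; apply: le_Rintegral => //; exact: bmeas_integrable. Qed.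

Lemma Rint_ae_eq f g : bmeas f -> bmeas g -> {ae mu, forall x, f x = g x} ->
  \int[mu]_x f x = \int[mu]_x g x.
Proof.
move=> [mf _] [mg _] fg; rewrite /Rintegral; congr fine.
apply: ae_eq_integral => //; try exact/measurable_EFinP.
by apply: filterS fg => x /= -> _.
Qed.

End BoundedFunctions.

#[local] Hint Resolve bmeas_cst bmeasD bmeasN bmeasB bmeasM bmeasX bmeas_sum : core.

(** Each list is a prefix of the later ones, so a difference of two partial sums is the sum over the
    suffix. *)
Lemma countable_chain (I : choiceType) (A : set I) : countable A ->
  exists s : nat -> seq I, [/\ forall n, uniq (s n),
    forall n i, i \in s n -> A i,
    forall i, A i -> exists N, forall n, (N <= n)%N -> i \in s n &
    forall n m, (n <= m)%N -> exists r, s m = s n ++ r].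
Proof.
move=> /countable_injP[g ginj].
(* [o] inverts the injection at the code [k]; [None] is for codes that no element of [A] has. *)
have ex k : exists o : option I, (forall i, o = Some i -> A i /\ g i = k) /\
    (forall i, A i -> g i = k -> o = Some i).
  have [[i [Ai gi]]|nex] := pselect (exists i, A i /\ g i = k).
    exists (Some i); split=> [j [<-]//|j Aj gj].
    by congr Some; apply: ginj; rewrite ?inE// gi gj.
  exists None; split=> // i Ai gi; exfalso; apply: nex; by exists i.
have [h hP] := choice ex.
have hin k i : h k = Some i -> A i /\ g i = k by exact: (hP k).1.
have mem n m i : (i \in pmap h (iota n m)) -> A i /\ (n <= g i < n + m)%N.
  rewrite mem_pmap => /mapP[k]; rewrite mem_iota => kn /esym/hin[Ai gi].
  by rewrite gi.
exists (fun n => pmap h (iota 0 n)); split.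
- move=> n; elim: n {1}0%N => [//|n IH] m /=.
  case hm : (h m) => [i|] /=; last exact: IH.
  rewrite IH andbT; apply/negP => /mem[_].
  by rewrite (hin _ _ hm).2 ltnn.
- by move=> n i /mem[].
- move=> i Ai; exists (g i).+1 => n gn; rewrite mem_pmap; apply/mapP.
  exists (g i); first by rewrite mem_iota.
  by rewrite ((hP _).2 i).
- move=> n m nm; exists (pmap h (iota n (m - n))).
  by rewrite -{1}(subnKC nm) iotaD pmap_cat.
Qed.

(** * Bessel and Parseval for a countable orthonormal family *)

Section Parseval.
Context d (T : measurableType d) (R : realType) (mu : probability T R).

(* A pair (f1, f2) stands for the complex function f1 + i f2, and ip is the real
   part of the complex inner product; e_i and i e_i count as two vectors. *)
Definition ip (f1 f2 g1 g2 : T -> R) : R := \int[mu]_x (f1 x * g1 x + f2 x * g2 x).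

Context (I : choiceType) (e1 e2 : I -> T -> R) (A : set I).
Hypothesis be1 : forall i, bmeas (e1 i).
Hypothesis be2 : forall i, bmeas (e2 i).
Hypothesis ON : forall i j, A i -> A j ->
  ip (e1 i) (e2 i) (e1 j) (e2 j) = (i == j)%:R.

Local Hint Resolve be1 be2 : core.

Lemma ip_sum (s : seq I) (c : I -> R) (g1 g2 : T -> R) : bmeas g1 -> bmeas g2 ->
  ip (fun x => \sum_(i <- s) c i * e1 i x) (fun x => \sum_(i <- s) c i * e2 i x) g1 g2
  = \sum_(i <- s) c i * ip (e1 i) (e2 i) g1 g2.
Proof.
move=> b1 b2; rewrite [RHS](eq_bigr
    (fun i => \int[mu]_x (c i * (e1 i x * g1 x + e2 i x * g2 x)))); last first.
  by move=> i _; rewrite RintZl//; apply: bmeasD; apply: bmeasM.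
rewrite -Rint_sum//; last first.
  by move=> i; apply: bmeasM => //; apply: bmeasD; apply: bmeasM.
apply: eq_Rintegral => x _; rewrite !mulr_suml -big_split /=.
by apply: eq_bigr => i _; ring.
Qed.

Lemma ip_sum_basis (s : seq I) (c : I -> R) j : uniq s -> (forall i, i \in s -> A i) ->
  A j -> ip (fun x => \sum_(i <- s) c i * e1 i x) (fun x => \sum_(i <- s) c i * e2 i x)
    (e1 j) (e2 j) = if j \in s then c j else 0.
Proof.
move=> us sA Aj; rewrite ip_sum//.
rewrite (eq_big_seq (fun i => c i * (i == j)%:R)); last first.
  by move=> i si; rewrite ON//; exact: sA.
case: ifPn => js.
  rewrite (bigD1_seq j)//= eqxx mulr1 big1 ?addr0// => i /negbTE ->.
  by rewrite mulr0.
rewrite big_seq big1// => i si; case: eqP => [ij|]; rewrite ?mulr0//.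
by rewrite -ij si in js.
Qed.

Lemma ipC f1 f2 g1 g2 : ip f1 f2 g1 g2 = ip g1 g2 f1 f2.
Proof. by apply: eq_Rintegral => x _; ring. Qed.

Lemma ip_sum_sum (s : seq I) (c : I -> R) : uniq s -> (forall i, i \in s -> A i) ->
  ip (fun x => \sum_(i <- s) c i * e1 i x) (fun x => \sum_(i <- s) c i * e2 i x)
     (fun x => \sum_(i <- s) c i * e1 i x) (fun x => \sum_(i <- s) c i * e2 i x)
  = \sum_(i <- s) c i ^+ 2.
Proof.
move=> us sA; rewrite ip_sum; try by apply: bmeas_sum => i; exact: bmeasM.
apply: eq_big_seq => i si; rewrite ipC ip_sum_basis ?si//; exact: sA.
Qed.

Context (f1 f2 : T -> R) (bf1 : bmeas f1) (bf2 : bmeas f2).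
Local Hint Resolve bf1 bf2 : core.

Let a i := ip f1 f2 (e1 i) (e2 i).
Let S1 s x := \sum_(i <- s) a i * e1 i x.
Let S2 s x := \sum_(i <- s) a i * e2 i x.

Let bS1 s : bmeas (S1 s). Proof. by apply: bmeas_sum => i; exact: bmeasM. Qed.
Let bS2 s : bmeas (S2 s). Proof. by apply: bmeas_sum => i; exact: bmeasM. Qed.
Local Hint Resolve bS1 bS2 : core.

(** Pythagoras: the coefficient sum occurs once as the squared norm of the partial sum and twice,
    with a minus sign, as the cross term. *)
Lemma dist_partial_sum (s : seq I) : uniq s -> (forall i, i \in s -> A i) ->
  \int[mu]_x ((f1 x - S1 s x) ^+ 2 + (f2 x - S2 s x) ^+ 2) =
  ip f1 f2 f1 f2 - \sum_(i <- s) a i ^+ 2.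
Proof.
move=> us sA.
have -> : ip f1 f2 f1 f2 - \sum_(i <- s) a i ^+ 2 =
    ip f1 f2 f1 f2 + (ip (S1 s) (S2 s) (S1 s) (S2 s) - 2 * ip (S1 s) (S2 s) f1 f2).
  rewrite ip_sum_sum// ip_sum//.
  under [X in 2 * X]eq_bigr => i _ do rewrite ipC -/(a i) -expr2.
  ring.
rewrite -RintZl; last by apply: bmeasD; apply: bmeasM.
rewrite -RintB; last by apply: bmeasM => //; apply: bmeasD; apply: bmeasM.
  rewrite -RintD; last 2 first.
  - by apply: bmeasD; apply: bmeasM.
  - apply: bmeasB; first by apply: bmeasD; apply: bmeasM.
    by apply: bmeasM => //; apply: bmeasD; apply: bmeasM.
  by apply: eq_Rintegral => x _; ring.
by apply: bmeasD; apply: bmeasM.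
Qed.

Lemma bessel (s : seq I) : uniq s -> (forall i, i \in s -> A i) ->
  \sum_(i <- s) a i ^+ 2 <= ip f1 f2 f1 f2.
Proof.
move=> us sA; rewrite -subr_ge0 -dist_partial_sum//.
by apply: Rintegral_ge0 => x _; rewrite addr_ge0// sqr_ge0.
Qed.

Hypothesis cA : countable A.
Hypothesis complete : forall u v : T -> R,
  measurable_fun setT u -> measurable_fun setT v ->
  (\int[mu]_x (u x ^+ 2)%:E < +oo)%E -> (\int[mu]_x (v x ^+ 2)%:E < +oo)%E ->
  (forall i, A i -> (\int[mu]_x (u x * e1 i x + v x * e2 i x)%:E = 0)%E) ->
  {ae mu, forall x, u x = 0 /\ v x = 0}.

(** The partial sums have an L^2 limit (V1, V2), and (f1 - V1, f2 - V2) is orthogonal to every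
    vector, hence zero by completeness. So the partial sums tend to f, and [dist_partial_sum] reads
    their distance to f as the missing mass. *)
Lemma parseval (eps : R) : 0 < eps ->
  exists s : seq I, [/\ uniq s, forall i, i \in s -> A i &
    ip f1 f2 f1 f2 - eps <= \sum_(i <- s) a i ^+ 2].
Proof.
move=> eps0; have [s [us sA sex scat]] := countable_chain cA.
pose sg n := \sum_(i <- s n) a i ^+ 2.
have sgmono : nondecreasing_seq sg.
  move=> n m /scat[r sr]; rewrite /sg sr big_cat /= lerDl.
  by apply: sumr_ge0 => i _; exact: sqr_ge0.
have sgcvg : cvgn sg.
  apply: nondecreasing_is_cvgn => //.
  by exists (ip f1 f2 f1 f2) => _ [n _ <-]; apply: bessel => //; exact: sA.
pose t n := limn sg - sg n.
have t0 : t @ \oo --> 0.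
  by rewrite -(subrr (limn sg)); apply: cvgB => //; exact: cvg_cst.
have msq (f : T -> R) : measurable_fun setT f ->
    measurable_fun setT (EFin \o (fun x => f x ^+ 2)).
  by move=> mf; apply/measurable_EFinP; exact: measurable_funX.
have cauchy m n : (n <= m)%N ->
    \int[mu]_x ((S1 (s m) x - S1 (s n) x) ^+ 2 + (S2 (s m) x - S2 (s n) x) ^+ 2)
    <= t n.
  move=> nm; have [r sr] := scat _ _ nm.
  have -> : \int[mu]_x ((S1 (s m) x - S1 (s n) x) ^+ 2 + (S2 (s m) x - S2 (s n) x) ^+ 2)
      = ip (S1 r) (S2 r) (S1 r) (S2 r).
    by apply: eq_Rintegral => x _; rewrite /S1 /S2 sr !big_cat /=; ring.
  have ur : uniq r by have := us m; rewrite sr cat_uniq => /and3P[].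
  rewrite ip_sum_sum//; last by move=> i ir; apply: (sA m); rewrite sr mem_cat ir orbT.
  have -> : \sum_(i <- r) a i ^+ 2 = sg m - sg n.
    by rewrite /sg sr big_cat /= addrAC subrr add0r.
  by rewrite lerB// nondecreasing_cvgn_le.
have cauchy1 m n : (n <= m)%N ->
    (\int[mu]_x ((S1 (s m) x - S1 (s n) x) ^+ 2)%:E <= (t n)%:E)%E.
  move=> nm; have b1 : bmeas (fun x => (S1 (s m) x - S1 (s n) x) ^+ 2).
    by apply: bmeasX; exact: bmeasB.
  have b2 : bmeas (fun x => (S2 (s m) x - S2 (s n) x) ^+ 2).
    by apply: bmeasX; exact: bmeasB.
  rewrite Rintegral_EFin// lee_fin; apply: le_trans (cauchy m n nm).
  by apply: Rint_le => //; [exact: bmeasD|move=> x; rewrite lerDl sqr_ge0].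
have cauchy2 m n : (n <= m)%N ->
    (\int[mu]_x ((S2 (s m) x - S2 (s n) x) ^+ 2)%:E <= (t n)%:E)%E.
  move=> nm; have b1 : bmeas (fun x => (S1 (s m) x - S1 (s n) x) ^+ 2).
    by apply: bmeasX; exact: bmeasB.
  have b2 : bmeas (fun x => (S2 (s m) x - S2 (s n) x) ^+ 2).
    by apply: bmeasX; exact: bmeasB.
  rewrite Rintegral_EFin// lee_fin; apply: le_trans (cauchy m n nm).
  by apply: Rint_le => //; [exact: bmeasD|move=> x; rewrite lerDr sqr_ge0].
have [V1 mV1 hV1] := riesz_fischer (fun n => (bS1 (s n)).1) t0 cauchy1.
have [V2 mV2 hV2] := riesz_fischer (fun n => (bS2 (s n)).1) t0 cauchy2.
(* Completeness is stated for square integrable functions, whereas [V1] and [V2] come merely as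
   measurable; (f - V)^2 <= 2 (f - S)^2 + 2 (S - V)^2 bridges this. *)
have L2 (f S V : T -> R) r : bmeas f -> bmeas S -> measurable_fun setT V ->
    (\int[mu]_x ((S x - V x) ^+ 2)%:E <= r%:E)%E ->
    (\int[mu]_x ((f x - V x) ^+ 2)%:E < +oo)%E.
  move=> bf bS mV SV.
  have b2 : bmeas (fun x => 2 * (f x - S x) ^+ 2).
    by apply: bmeasM => //; apply: bmeasX; exact: bmeasB.
  have mSV : measurable_fun setT (EFin \o (fun x => (S x - V x) ^+ 2)).
    by apply: msq; apply: measurable_funB => //; exact: bS.1.
  apply: (@le_lt_trans _ _ (\int[mu]_x ((2 * (f x - S x) ^+ 2)%:E +
      2%:E * ((S x - V x) ^+ 2)%:E))%E).
    apply: ge0_le_integral => //.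
    - by move=> x _; rewrite lee_fin sqr_ge0.
    - by apply: msq; apply: measurable_funB => //; exact: bf.1.
    - apply: emeasurable_funD; first by apply/measurable_EFinP; exact: b2.1.
      exact: measurable_funeM.
    - move=> x _; rewrite -EFinM -EFinD lee_fin -subr_ge0.
      have -> : 2 * (f x - S x) ^+ 2 + 2 * (S x - V x) ^+ 2 - (f x - V x) ^+ 2 =
          ((f x - S x) - (S x - V x)) ^+ 2 by ring.
      exact: sqr_ge0.
  rewrite ge0_integralD//; last 4 first.
  - by move=> x _; rewrite lee_fin mulr_ge0// sqr_ge0.
  - by apply/measurable_EFinP; exact: b2.1.
  - by move=> x _; rewrite -EFinM lee_fin mulr_ge0// sqr_ge0.
  - exact: measurable_funeM.
  rewrite ge0_integralZl//; last by move=> x _; rewrite lee_fin sqr_ge0.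
  rewrite Rintegral_EFin//; apply: lte_add_pinfty; rewrite ?ltry//.
  apply: (@le_lt_trans _ _ (2%:E * r%:E)%E); last by rewrite -EFinM ltry.
  by rewrite lee_pmul2l.
have mu1 : measurable_fun setT (fun x => f1 x - V1 x).
  by apply: measurable_funB => //; exact: bf1.1.
have mu2 : measurable_fun setT (fun x => f2 x - V2 x).
  by apply: measurable_funB => //; exact: bf2.1.
have aef : {ae mu, forall x, f1 x - V1 x = 0 /\ f2 x - V2 x = 0}.
  apply: complete => //.
  - exact: L2 (hV1 0%N).
  - exact: L2 (hV2 0%N).
  move=> i Ai; have [N hN] := sex i Ai.
  have [[m1 [M1 hM1]] [m2 [M2 hM2]]] := (be1 i, be2 i).
  pose M := `|M1| + `|M2| + 1.
  have M0 : 0 < M by rewrite /M ltr_wpDl// addr_ge0.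
  have hM1' x : `|e1 i x| <= M.
    apply: le_trans (hM1 x) _; apply: le_trans (ler_norm _) _.
    by rewrite /M -addrA lerDl addr_ge0.
  have hM2' x : `|e2 i x| <= M.
    apply: le_trans (hM2 x) _; apply: le_trans (ler_norm _) _.
    by rewrite /M addrAC lerDr addr_ge0.
  (* Split f - V at the partial sum S_n. Once [i] is in [s n], f - S_n is exactly orthogonal to the
     vector [i]; S_n - V has small L^1 norm, and the vector is bounded by [M]. *)
  suff small (del : R) : 0 < del ->
      (`|\int[mu]_x ((f1 x - V1 x) * e1 i x + (f2 x - V2 x) * e2 i x)%:E| <= del%:E)%E.
    apply/eqP; rewrite -abse_eq0 eq_le abse_ge0 andbT; apply/lee_addgt0Pr => del /small.
    by rewrite add0e.
  move=> del0; pose r := del / (2 * M).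
  have r0 : 0 < r by rewrite divr_gt0// mulr_gt0.
  have [n [Nn tn]] : exists n, (N <= n)%N /\ t n <= r ^+ 2.
    move/cvgrPdist_le : t0 => /(_ (r ^+ 2)); rewrite exprn_gt0// => /(_ isT)[n0 _ hn0].
    exists (maxn N n0); split; first exact: leq_maxl.
    have := hn0 (maxn N n0) (leq_maxr _ _); rewrite /= sub0r normrN.
    by apply: le_trans; exact: ler_norm.
  pose p x := S1 (s n) x - V1 x; pose q x := S2 (s n) x - V2 x.
  have mp : measurable_fun setT p by apply: measurable_funB => //; exact: (bS1 _).1.
  have mq : measurable_fun setT q by apply: measurable_funB => //; exact: (bS2 _).1.
  have ap : (\int[mu]_x `|p x|%:E <= r%:E)%E.
    by apply: integral_abs_le => //; apply: le_trans (hV1 n) _; rewrite lee_fin.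
  have aq : (\int[mu]_x `|q x|%:E <= r%:E)%E.
    by apply: integral_abs_le => //; apply: le_trans (hV2 n) _; rewrite lee_fin.
  pose b x := (f1 x - S1 (s n) x) * e1 i x + (f2 x - S2 (s n) x) * e2 i x.
  have bb : bmeas b by apply: bmeasD; apply: bmeasM => //; exact: bmeasB.
  have intb : (\int[mu]_x (b x)%:E = 0)%E.
    rewrite Rintegral_EFin//.
    have -> : \int[mu]_x b x = a i - ip (S1 (s n)) (S2 (s n)) (e1 i) (e2 i).
      rewrite -RintB; last 2 first.
      - by apply: bmeasD; apply: bmeasM.
      - by apply: bmeasD; apply: bmeasM.
      by apply: eq_Rintegral => x _; rewrite /b; ring.
    rewrite ip_sum_basis//; last exact: sA.
    by rewrite hN// subrr.
  pose w x := p x * e1 i x + q x * e2 i x.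
  have mw : measurable_fun setT w by apply: measurable_funD; apply: measurable_funM.
  have mabs (f : T -> R) : measurable_fun setT f ->
      measurable_fun setT (EFin \o (fun x => `|f x|)).
    by move=> mf; apply/measurable_EFinP; exact: measurableT_comp.
  have aw : (\int[mu]_x `|w x|%:E <= del%:E)%E.
    apply: (@le_trans _ _ (\int[mu]_x (M%:E * `|p x|%:E + M%:E * `|q x|%:E))%E).
      apply: ge0_le_integral => //.
      - exact: mabs.
      - by apply: emeasurable_funD; apply: measurable_funeM; exact: mabs.
      - move=> x _; rewrite -!EFinM -EFinD lee_fin.
        apply: le_trans (ler_normD _ _) _; rewrite !normrM.
        by rewrite (mulrC `|p x|) (mulrC `|q x|); apply: lerD; exact: ler_wpM2r.
    rewrite ge0_integralD//; last 4 first.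
    - by move=> x _; rewrite -EFinM lee_fin mulr_ge0// ltW.
    - by apply: measurable_funeM; exact: mabs.
    - by move=> x _; rewrite -EFinM lee_fin mulr_ge0// ltW.
    - by apply: measurable_funeM; exact: mabs.
    rewrite !ge0_integralZl//; try (by rewrite lee_fin ltW); try exact: mabs.
    apply: (@le_trans _ _ (M%:E * r%:E + M%:E * r%:E)%E).
      by apply: leeD; rewrite lee_pmul2l.
    rewrite -!EFinM -EFinD lee_fin /r le_eqVlt; apply/orP; left; apply/eqP.
    by field; rewrite gt_eqF.
  have iw : mu.-integrable setT (EFin \o w).
    apply/integrableP; split; first exact/measurable_EFinP.
    by apply: le_lt_trans aw _; exact: ltry.
  have -> : (\int[mu]_x ((f1 x - V1 x) * e1 i x + (f2 x - V2 x) * e2 i x)%:E =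
      \int[mu]_x ((EFin \o b) x + (EFin \o w) x))%E.
    by apply: eq_integral => x _; rewrite /b /w /p /q /= -EFinD; congr EFin; ring.
  rewrite integralD//; last exact: bmeas_integrable.
  rewrite [X in `|X + _|%E](_ : _ = 0%E)// add0e.
  by apply: le_trans aw; apply: le_abse_integral => //; exact/measurable_EFinP.
have [n tn] : exists n, t n <= eps / 2.
  move/cvgrPdist_le : t0 => /(_ (eps / 2)); rewrite divr_gt0// => /(_ isT)[n0 _ hn0].
  exists n0; have := hn0 n0 (leqnn _); rewrite /= sub0r normrN.
  by apply: le_trans; exact: ler_norm.
exists (s n); split => //; first exact: sA.
rewrite lerBlDr -lerBlDl -(dist_partial_sum (us n) (sA n)).
have b1 : bmeas (fun x => (f1 x - S1 (s n) x) ^+ 2).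
  by apply: bmeasX; exact: bmeasB.
have b2 : bmeas (fun x => (f2 x - S2 (s n) x) ^+ 2).
  by apply: bmeasX; exact: bmeasB.
rewrite RintD// (splitr eps).
apply: lerD; rewrite -lee_fin -Rintegral_EFin//; apply: (@le_trans _ _ (t n)%:E);
  rewrite ?lee_fin//.
- apply: le_trans (hV1 n); apply: ae_ge0_le_integral => //.
  + by move=> x _; rewrite lee_fin sqr_ge0.
  + by apply/measurable_EFinP; exact: b1.1.
  + by move=> x _; rewrite lee_fin sqr_ge0.
  + by apply: msq; apply: measurable_funB => //; exact: (bS1 _).1.
  + apply: filterS aef => x [/eqP]; rewrite subr_eq0 => /eqP -> _ _.
    by rewrite -sqrrN opprB.
- apply: le_trans (hV2 n); apply: ae_ge0_le_integral => //.
  + by move=> x _; rewrite lee_fin sqr_ge0.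
  + by apply/measurable_EFinP; exact: b2.1.
  + by move=> x _; rewrite lee_fin sqr_ge0.
  + by apply: msq; apply: measurable_funB => //; exact: (bS2 _).1.
  + apply: filterS aef => x [_ /eqP]; rewrite subr_eq0 => /eqP -> _.
    by rewrite -sqrrN opprB.
Qed.

End Parseval.

Lemma self_similar_integral d (T : measurableType d) (R : realType)
    (mu : {measure set T -> \bar R}) (phi : nat -> T -> T) (N : nat)
    (c : {nonneg R}) (f : T -> \bar R) :
  (forall k, measurable_fun setT (phi k)) ->
  (forall E, measurable E ->
    mu E = (c%:num%:E * \sum_(k < N) mu (phi k @^-1` E))%E) ->
  measurable_fun setT f -> (forall x, 0 <= f x)%E ->
  (\int[mu]_x f x = c%:num%:E * \sum_(k < N) \int[mu]_x f (phi k x))%E.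
Proof.
move=> mphi hmu mf f0.
pose p_ k : {measure set T -> \bar R} := pushforward mu (phi k).
pose m_ := p_ mphi.
rewrite (@eq_measure_integral _ _ _ _ (mscale c (msum m_ N))); last first.
  by move=> E mE _; rewrite hmu.
rewrite ge0_integral_mscale// ge0_integral_measure_sum//; congr (_ * _)%E.
apply: eq_bigr => k _.
have -> : (\int[m_ k]_x f x = \int[pushforward mu (phi k)]_x f x)%E by [].
by rewrite (@ge0_integral_pushforward _ _ _ _ _ (phi k) (mphi k)).
Qed.

(** * Trigonometry of the mask zeros *)

Section Trigonometry.
Context (R : realType).

Lemma cosD2pin (x : R) n : cos (x + 2 * pi * n%:R) = cos x.
Proof.
rewrite -[RHS](periodicn (@cosD2pi R) n); congr cos.
by rewrite -[pi *+ 2 *+ n]mulr_natr -[pi *+ 2]mulr_natl.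
Qed.

(** With y the residue of x modulo 2 pi, the double angle formula gives sin (y/2) = 0 with y/2 in
    [0, pi), hence y = 0. *)
Lemma cos_eq1 (x : R) : cos x = 1 -> exists k : int, x = 2 * pi * k%:~R.
Proof.
move=> x1; have pi0 := pi_gt0 R.
have p0 : 0 < 2 * pi :> R by rewrite mulr_gt0.
pose k := Num.floor (x / (2 * pi)); pose y := x - 2 * pi * k%:~R.
have y0 : 0 <= y.
  have := ge_floor (x / (2 * pi)); rewrite ler_pdivlMr// -/k => h.
  by rewrite /y subr_ge0 mulrC.
have y1 : y < 2 * pi.
  have := floorD1_gt (x / (2 * pi)); rewrite ltr_pdivrMr// -/k intrD mulrDl mul1r.
  by rewrite /y ltrBlDl mulrC [X in _ + X]mulrC.
have cy : cos y = 1.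
  rewrite -x1 /y; case: (k) => n.
    by rewrite -[in RHS](subrK (2 * pi * n%:R) x) cosD2pin.
  by rewrite NegzE intrN mulrN opprK cosD2pin.
have sy : sin (y / 2) = 0.
  have := cos_mulr2n (y / 2); rewrite -[(y / 2) *+ 2]mulr_natr divfK// cy cos2sin2 => h.
  by apply/eqP; rewrite -sqrf_eq0; apply/eqP; lra.
exists k; apply/eqP; rewrite -subr_eq0 -/y; apply/eqP.
apply: contra_eq sy => yn0; rewrite gt_eqF// sin_gt0_pi//.
have yp : 0 < y by rewrite lt0r yn0.
by apply/andP; split; [rewrite divr_gt0|lra].
Qed.

(** Tripling the angle turns the cosine -1/2 into 1, so 3 x is an integer. Were it divisible by 3, x
    would be an integer and the original cosine 1. *)
Lemma cos_eqN1half (x : R) : cos (2 * pi * x) = - 2^-1 ->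
  exists k : int, 3 * x = k%:~R /\ ~~ (3 %| k)%Z.
Proof.
move=> h; have pi0 := pi_gt0 R.
have c3 : cos (2 * pi * (3 * x)) = 1.
  have -> : 2 * pi * (3 * x) = 2 * pi * x + 2 * pi * x + 2 * pi * x by ring.
  have := sin2cos2 (2 * pi * x); rewrite cosD cosD sinD h.
  move: (sin _) => s s2.
  have -> : (- 2^-1 * - 2^-1 - s * s) * - 2^-1 - (s * - 2^-1 + - 2^-1 * s) * s =
    - 8^-1 + (3 / 2) * s ^+ 2 :> R by field.
  by rewrite s2; field.
have [k hk] := cos_eq1 c3.
have k3 : 3 * x = k%:~R by apply: (mulfI (_ : 2 * pi != 0 :> R)); rewrite ?mulf_neq0 ?gt_eqF.
exists k; split => //; apply/negP => /dvdzP[j kj].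
have xj : x = j%:~R.
  by apply: (mulfI (_ : 3 != 0 :> R)) => //; rewrite k3 kj intrM mulrC.
have : cos (2 * pi * x) = 1.
  rewrite xj; case: (j) => n; first by rewrite -[X in cos X]add0r cosD2pin cos0.
  by rewrite NegzE intrN mulrN cosN -[X in cos X]add0r cosD2pin cos0.
by rewrite h => ?; lra.
Qed.

(* The hypotheses are the two parts of 1 + e^{ia} + e^{ib} = 0. *)
Lemma mask_zero (a b : R) : 1 + cos a + cos b = 0 -> sin a + sin b = 0 ->
  cos a = - 2^-1 /\ cos b = - 2^-1.
Proof.
move=> hc hs.
have ca := cos2Dsin2 a; have cb := cos2Dsin2 b.
have hsb : sin b = - sin a by lra.
have hcb : cos b = - 1 - cos a by lra.
rewrite hsb hcb in cb.
have cae : cos a = - 2^-1.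
  have : 1 + 2 * cos a = 0.
    have -> : 1 + 2 * cos a = ((-1 - cos a) ^+ 2 + (- sin a) ^+ 2) - (cos a ^+ 2 + sin a ^+ 2).
      by ring.
    by rewrite ca cb subrr.
  by move=> ?; lra.
by split => //; rewrite hcb cae; lra.
Qed.

Lemma cos_ge_cos1 (t : R) : `|t| <= 1 -> cos 1 <= cos t.
Proof.
move=> t1; rewrite -(cos_norm t) leNgt; apply/negP.
have pi2 := pi_ge2 R.
rewrite ltr_cos ?in_itv /=; first by rewrite ltNge t1.
- by lra.
- by rewrite normr_ge0 /=; lra.
Qed.

End Trigonometry.

(** * Self-similarity: support, cylinders and Fourier transform of mu *)

Section Invariance.
Context (R : realType) (q1 q2 : nat).
Notation P2 := (R * R)%type.
Context (mu : probability P2 R) (hmu : sierpinski_invariant q1 q2 mu).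
Hypothesis hq1 : (1 <= q1)%N.
Hypothesis hq2 : (1 <= q2)%N.

Local Notation A1 := (3 * q1%:R : R).
Local Notation A2 := (3 * q2%:R : R).

Lemma A1_ge3 : 3 <= A1.
Proof. by rewrite -{1}(mulr1 3) ler_pM2l// ler1n. Qed.
Lemma A2_ge3 : 3 <= A2.
Proof. by rewrite -{1}(mulr1 3) ler_pM2l// ler1n. Qed.
Lemma A1_gt0 : 0 < A1. Proof. by have := A1_ge3; lra. Qed.
Lemma A2_gt0 : 0 < A2. Proof. by have := A2_ge3; lra. Qed.
Local Hint Resolve A1_gt0 A2_gt0 : core.

Lemma measurable_affine (r1 s1 r2 s2 : R) :
  measurable_fun setT (fun x : P2 => (r1 * x.1 + s1, r2 * x.2 + s2)).
Proof.
by apply: measurable_fun_pair; apply: measurable_funD => //; apply: measurable_funM.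
Qed.

Lemma bmeas_comp (f : P2 -> R) (h : P2 -> P2) : bmeas f -> measurable_fun setT h ->
  bmeas (fun x => f (h x)).
Proof.
move=> [mf [M fM]] mh; split; first exact: measurableT_comp.
by exists M => x; exact: fM.
Qed.

(** Inverse branch A^-1 (x + d) of the iterated function system. *)
Definition phi (d x : P2) : P2 := ((x.1 + d.1) / A1, (x.2 + d.2) / A2).

Lemma measurable_phi d : measurable_fun setT (phi d).
Proof.
have -> : phi d = fun x => (A1^-1 * x.1 + d.1 / A1, A2^-1 * x.2 + d.2 / A2).
  by apply/funext => x; rewrite /phi; congr pair; rewrite mulrDl mulrC.
exact: measurable_affine.
Qed.

(** Invariance is stated with forward images; rewritten as preimages they become pushforwards of
    mu. *)
Lemma image_matA d (E : set P2) :
  [set ((matA q1 q2 x).1 - d.1, (matA q1 q2 x).2 - d.2) | x in E] = phi d @^-1` E.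
Proof.
have a1 := lt0r_neq0 A1_gt0; have a2 := lt0r_neq0 A2_gt0.
apply/seteqP; split=> [_ [x Ex <-]|x Ex] /=.
  rewrite /phi /matA /= !subrK ![_ * _ / _]mulrC !mulKf//.
  by rewrite -surjective_pairing.
by exists (phi d x) => //; rewrite /matA /phi /= ![_ * (_ / _)]mulrC !divfK// !addrK -surjective_pairing.
Qed.

Lemma mu_invariant (E : set P2) : measurable E ->
  (mu E = (3^-1)%:E * \sum_(k < 3) mu (phi (nth (0, 0)%R (digits R) k) @^-1` E))%E.
Proof.
move=> mE; rewrite hmu//; congr (_ * _)%E.
by rewrite /digits !big_cons big_nil !big_ord_recl big_ord0 !image_matA.
Qed.

Lemma Rint_invariant (g : P2 -> R) : bmeas g ->
  \int[mu]_x g x = 3^-1 * (\int[mu]_x g (phi (0, 0) x) + \int[mu]_x g (phi (1, 0) x)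
    + \int[mu]_x g (phi (0, 1) x)).
Proof.
move=> bg; have [mg [M gM]] := bg.
(* [self_similar_integral] asks for a nonnegative function, so the bound [M] is added; it cancels
   because the three weights 1/3 sum to 1. *)
have g0 x : 0 <= g x + M.
  by have := gM x; rewrite ler_norml => /andP[h _]; rewrite -lerBlDr sub0r.
have bgM : bmeas (fun x => g x + M) by exact: bmeasD.
have bphi d : bmeas (fun x => g (phi d x)).
  by apply: (@bmeas_comp g) => //; exact: measurable_phi.
have bphiM d : bmeas (fun x => g (phi d x) + M) by exact: bmeasD.
have c0 : 0 <= 3^-1 :> R by rewrite invr_ge0.
pose c := NngNum c0.
have := @self_similar_integral _ P2 R mu
  (fun k => phi (nth (0, 0)%R (digits R) k)) 3 c
  (fun x => (g x + M)%:E).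
move=> /(_ (fun k => measurable_phi _) mu_invariant); rewrite !big_ord_recl big_ord0 /= adde0 !Rintegral_EFin//.
rewrite -!EFinD -EFinM => h.
have mgM : measurable_fun setT (EFin \o (fun x => g x + M)).
  by apply/measurable_EFinP; exact: bgM.1.
have gM0 x : (0 <= (g x + M)%:E)%E by rewrite lee_fin.
have /(congr1 fine) /= := h mgM gM0; rewrite !RintD// !Rint_cst => k; lra.
Qed.

(** The interval |x - 1/4| <= 1/4, that is [0, 1/2], is mapped into itself by x -> (x + d) / a, the
    extreme case being (1/2 + 1) / 3 = 1/2. An excess over the interval after this contraction comes
    from one at least three times as large. *)
Lemma contract_away (a x d s : R) : 3 <= a -> 0 <= s -> d = 0 \/ d = 1 ->
  1/4 + s < `|(x + d) / a - 1/4| -> 1/4 + 3 * s < `|x - 1/4|.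
Proof.
move=> a3 s0 hd; have a0 : 0 < a by lra.
have -> : (x + d) / a - 1/4 = ((x - 1/4) + (1/4 + d - a / 4)) / a.
  by field; rewrite gt_eqF.
rewrite normrM normfV (gtr0_norm a0) ltr_pdivlMr//.
have h1 : `|1/4 + d - a/4| <= (a - 1) / 4.
  by rewrite ler_norml; case: hd => ->; lra.
have h2 : 3 * s <= a * s by rewrite ler_wpM2r.
have h3 := ler_normD (x - 1/4) (1/4 + d - a/4).
by move=> h; lra.
Qed.

(** By invariance the mass beyond excess s is at most the mass beyond 3 s. Iterating sends the
    excess to infinity and the mass to zero. The start must be positive to grow; 1/8 gives 1/4 + 1/8
    = 3/8. *)
Lemma ae_coord (c : P2 -> R) : measurable_fun setT c ->
  (forall d x s, d \in digits R -> 0 <= s ->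
    1/4 + s < `|c (phi d x) - 1/4| -> 1/4 + 3 * s < `|c x - 1/4|) ->
  {ae mu, forall x, `|c x - 1/4| <= 3/8}.
Proof.
move=> mc hc; pose E s := [set x | 1/4 + s < `|c x - 1/4|].
have mE s : measurable (E s).
  rewrite -[E s]setTI; apply: (@measurable_fun_ltr _ _ _ setT (fun=> 1/4 + s)
    (fun x => `|c x - 1/4|)) => //.
  by apply: measurableT_comp => //; exact: measurable_funB.
have step s : 0 <= s -> (mu (E s) <= mu (E (3 * s)%R))%E.
  move=> s0; rewrite [leLHS]mu_invariant//.
  apply: (@le_trans _ _ ((3^-1)%:E * \sum_(k < 3) mu (E (3 * s)%R))%E).
    rewrite lee_pmul2l//; apply: lee_sum => k _; apply: le_measure; rewrite ?inE//.
      by rewrite -[X in measurable X]setTI; exact: measurable_phi.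
    move=> x /=; apply: hc => //; apply: mem_nth; exact: ltn_ord.
  rewrite !big_ord_recl big_ord0 adde0.
  have [r ->] : exists r, mu (E (3 * s)%R) = r%:E.
    by exists (fine (mu (E (3 * s)))); rewrite fineK// fin_num_measure.
  by rewrite -!EFinD -EFinM lee_fin; lra.
have iter n : (mu (E (8^-1)%R) <= mu (E (3 ^+ n / 8)%R))%E.
  elim: n => [|n IH]; first by rewrite expr0 mul1r.
  apply: (le_trans IH); rewrite exprS -mulrA; apply: step.
  by rewrite divr_ge0// exprn_ge0.
have mono : nonincreasing_seq (fun n => E (3 ^+ n / 8)).
  move=> n m nm; apply/subsetPset => x /=; apply: le_lt_trans.
  by rewrite lerD2l ler_pM2r// ler_weXn2l// ler1n.
have empty : \bigcap_n E (3 ^+ n / 8) = set0.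
  apply/seteqP; split => // x h.
  have [n hn] : exists n, `|c x - 1/4| <= n%:R :> R.
    exists (Num.truncn `|c x - 1/4|).+1; apply: ltW; exact: truncnS_gt.
  have := h (8 * n)%N I; rewrite /E /= => /lt_le_trans /(_ hn).
  have : (8 * n)%:R <= 3 ^+ (8 * n) :> R.
    by rewrite -natrX ler_nat ltnW// ltn_expl.
  by rewrite natrM => *; lra.
have cv := @nonincreasing_cvg_mu _ _ _ mu (fun n => E (3 ^+ n / 8)) _ (fun n => mE _) _ mono.
rewrite empty measure0 in cv.
exists (E (8^-1)); split.
- exact: mE.
- apply/eqP; rewrite eq_le measure_ge0 andbT.
  have cv0 : (mu \o (fun n => E (3 ^+ n / 8))) @ \oo --> 0%E.
    apply: cv; last exact: measurable0.
    by apply: (le_lt_trans (probability_le1 mu (mE _))); exact: ltry.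
  rewrite -(cvg_lim (@ereal_hausdorff R) cv0).
  apply: lime_ge; first by apply/cvg_ex; exists 0%E.
  by apply: nearW => n; exact: iter.
- move=> x /= /negP; rewrite -ltNge => h; rewrite /E /=.
  by have -> : 1/4 + 8^-1 = 3/8 :> R by field.
Qed.

(** The square [-1/8, 5/8]^2. It contains the origin, so A^-N Q lies in Q; its side 3/4 is below 1,
    so its translates by the nonzero digits miss it. *)
Definition Q : set P2 := [set x | `|x.1 - 1/4| <= 3/8 /\ `|x.2 - 1/4| <= 3/8].

Lemma ae_Q : {ae mu, forall x, Q x}.
Proof.
have h1 : {ae mu, forall x, `|x.1 - 1/4| <= 3/8}.
  apply: ae_coord; first exact: measurable_fst.
  move=> d x s hd s0; apply: contract_away => //; first exact: A1_ge3.
  by move: hd; rewrite !inE => /or3P[]/eqP ->; [left|right|left].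
have h2 : {ae mu, forall x, `|x.2 - 1/4| <= 3/8}.
  apply: ae_coord; first exact: measurable_snd.
  move=> d x s hd s0; apply: contract_away => //; first exact: A2_ge3.
  by move: hd; rewrite !inE => /or3P[]/eqP ->; [left|left|right].
by apply: filterS2 h1 h2 => x.
Qed.

Lemma measurable_Q : measurable Q.
Proof.
have -> : Q = [set x | `|x.1 - 1/4| <= 3/8] `&` [set x | `|x.2 - 1/4| <= 3/8] by [].
apply: measurableI; rewrite -[X in measurable X]setTI.
- apply: (@measurable_fun_ler _ _ _ setT (fun x : P2 => `|x.1 - 1/4|) (fun=> 3/8)) => //.
  by apply: measurableT_comp => //; apply: measurable_funB => //; exact: measurable_fst.
- apply: (@measurable_fun_ler _ _ _ setT (fun x : P2 => `|x.2 - 1/4|) (fun=> 3/8)) => //.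
  by apply: measurableT_comp => //; apply: measurable_funB => //; exact: measurable_snd.
Qed.

Lemma bmeas_indicQ : bmeas (fun x => \1_Q x : R).
Proof.
split; first exact: measurable_indic measurable_Q.
by exists 1 => x; rewrite indicE ger0_norm// lern1 leq_b1.
Qed.

Definition matApow N (x : P2) : P2 := (A1 ^+ N * x.1, A2 ^+ N * x.2).

Lemma measurable_matApow N : measurable_fun setT (matApow N).
Proof.
have -> : matApow N = fun x => (A1 ^+ N * x.1 + 0, A2 ^+ N * x.2 + 0).
  by apply/funext => x; rewrite !addr0.
exact: measurable_affine.
Qed.

Lemma Q_coord (a x : R) N : 3 <= a -> `|a ^+ N * x - 1/4| <= 3/8 -> `|x - 1/4| <= 3/8.
Proof.
move=> a3; have : 1 <= a ^+ N by rewrite exprn_ege1//; lra.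
set b := a ^+ N => b1; rewrite !ler_norml => /andP[h1 h2].
have [x0|x0] := leP 0 x.
  have : x <= b * x by rewrite ler_peMl.
  by move=> ?; apply/andP; split; lra.
have : b * x <= x by rewrite ler_neMl// ltW.
by move=> ?; apply/andP; split; lra.
Qed.

Lemma Q_matApow N x : Q (matApow N x) -> Q x.
Proof. by move=> [/= h1 h2]; split; [exact: Q_coord A1_ge3 h1|exact: Q_coord A2_ge3 h2]. Qed.

(** The cylinder A^-N Q is reached by choosing the digit (0, 0) N times, each choice costing a
    factor 1/3; up to the factor 3^-N, A^N carries mu restricted to it back to mu. *)
Lemma Rint_cylinder N (g : P2 -> R) : bmeas g ->
  \int[mu]_x (\1_Q (matApow N x) * g (matApow N x)) = 3^-1 ^+ N * \int[mu]_x g x.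
Proof.
move=> bg; pose F N x := \1_Q (matApow N x) * g (matApow N x) : R.
have bF n : bmeas (F n).
  apply: (@bmeas_comp (fun x => \1_Q x * g x) (matApow n)).
    by apply: bmeasM => //; exact: bmeas_indicQ.
  exact: measurable_matApow.
suff cyl n : \int[mu]_x F n x = 3^-1 ^+ n * \int[mu]_x g x by exact: cyl.
elim: n => [|n IH].
  rewrite expr0 mul1r; apply: Rint_ae_eq => //.
  apply: filterS ae_Q => x Qx; rewrite /F /matApow !expr0 !mul1r -surjective_pairing.
  by rewrite indicE mem_set// mul1r.
have shift d x : F n.+1 (phi d x) = F n (x.1 + d.1, x.2 + d.2).
  have -> // : F n.+1 (phi d x) = F n (A1 * (phi d x).1, A2 * (phi d x).2).
    by rewrite /F /matApow !exprSr /= !mulrA.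
  by rewrite /phi /= ![_ * (_ / _)]mulrC !divfK// gt_eqF.
have bshift (d : P2) : bmeas (fun x : P2 => F n (x.1 + d.1, x.2 + d.2)).
  apply: (@bmeas_comp (F n) (fun x => (x.1 + d.1, x.2 + d.2))) => //.
  have -> : (fun x : P2 => (x.1 + d.1, x.2 + d.2)) = fun x => (1 * x.1 + d.1, 1 * x.2 + d.2).
    by apply/funext => x; rewrite !mul1r.
  exact: measurable_affine.
(* For a nonzero digit, x + d lies off Q for almost every x, and [F n] vanishes off A^-n Q, a subset
   of Q. *)
have zero (d : P2) : d = (1, 0) \/ d = (0, 1) -> \int[mu]_x F n (x.1 + d.1, x.2 + d.2) = 0.
  move=> hd; rewrite -[RHS](Rint_cst mu 0); apply: Rint_ae_eq => //.
  apply: filterS ae_Q => x [Qx1 Qx2]; rewrite /F indicE memNset ?mul0r//.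
  move=> /Q_matApow[/=]; move: Qx1 Qx2; rewrite !ler_norml.
  by case: hd => -> /=; lra.
rewrite (Rint_invariant (bF n.+1)).
under eq_Rintegral do rewrite shift.
under [X in _ + X + _]eq_Rintegral do rewrite shift.
under [X in _ + _ + X]eq_Rintegral do rewrite shift.
rewrite (zero (1, 0)); last by left.
rewrite (zero (0, 1)); last by right.
rewrite !addr0 exprS -mulrA -IH; congr (_ * _).
by apply: eq_Rintegral => x _; rewrite /= !addr0 -surjective_pairing.
Qed.

Lemma Rint_ae_le (f g : P2 -> R) : bmeas f -> bmeas g -> {ae mu, forall x, f x <= g x} ->
  \int[mu]_x f x <= \int[mu]_x g x.
Proof.
move=> bf bg fg; rewrite -subr_ge0 -RintB//.
have babs : bmeas (fun x => `|g x - f x|).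
  have [m [M hM]] : bmeas (fun x => g x - f x) by exact: bmeasB.
  by split; [exact: measurableT_comp|exists M => x; rewrite normr_id].
rewrite (_ : \int[mu]_x _ = \int[mu]_x `|g x - f x|); first exact: Rintegral_ge0.
apply: Rint_ae_eq => //; first exact: bmeasB.
by apply: filterS fg => x fgx; rewrite ger0_norm// subr_ge0.
Qed.

Lemma measurable_dot2 (xi : P2) : measurable_fun setT (fun x : P2 => dot2 xi x).
Proof.
by apply: measurable_funD; exact: measurable_funM.
Qed.

Lemma bmeas_cos (c : P2 -> R) : measurable_fun setT c -> bmeas (fun x => cos (c x)).
Proof.
move=> mc; split; last by exists 1 => x; exact: cos_max.
apply: (measurableT_comp _ mc).
by apply: continuous_measurable_fun; exact: continuous_cos.
Qed.

Lemma bmeas_sin (c : P2 -> R) : measurable_fun setT c -> bmeas (fun x => sin (c x)).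
Proof.
move=> mc; split; last by exists 1 => x; exact: sin_max.
apply: (measurableT_comp _ mc).
by apply: continuous_measurable_fun; exact: continuous_sin.
Qed.

Lemma bmeas_ecos (xi : P2) : bmeas (ecos xi).
Proof. by apply: bmeas_cos; apply: measurable_funM => //; exact: measurable_dot2. Qed.

Lemma bmeas_esin (xi : P2) : bmeas (esin xi).
Proof.
by apply: bmeasN; apply: bmeas_sin; apply: measurable_funM => //; exact: measurable_dot2.
Qed.
Local Hint Resolve bmeas_ecos bmeas_esin : core.

(* |mu^(xi)|^2 *)
Definition fourier2 (xi : P2) : R :=
  (\int[mu]_x ecos xi x) ^+ 2 + (\int[mu]_x esin xi x) ^+ 2.

Local Notation Ainv := (matA_invpow q1 q2).

(** Squared modulus of the mask (1 + e(eta.1) + e(eta.2)) / 3. *)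
Definition mask2 (eta : P2) : R :=
  (3^-1 * (1 + cos (2 * pi * eta.1) + cos (2 * pi * eta.2))) ^+ 2 +
  (3^-1 * (sin (2 * pi * eta.1) + sin (2 * pi * eta.2))) ^+ 2.

(** Squared modulus of the refinement equation mu^(xi) = m(A^-1 xi) mu^(A^-1 xi), m the mask: the
    invariance of mu tested on an exponential. *)
Lemma fourier2_step xi : fourier2 xi = mask2 (Ainv 1 xi) * fourier2 (Ainv 1 xi).
Proof.
set eta := Ainv 1 xi.
have a1 := lt0r_neq0 A1_gt0; have a2 := lt0r_neq0 A2_gt0.
have dotphi d x : 2 * pi * dot2 xi (phi d x) = 2 * pi * dot2 eta x + 2 * pi * dot2 eta d.
  by rewrite /dot2 /eta /phi /matA_invpow /= !expr1; ring.
have ce d x : ecos xi (phi d x) =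
    cos (2 * pi * dot2 eta d) * ecos eta x + sin (2 * pi * dot2 eta d) * esin eta x.
  by rewrite /ecos /esin dotphi cosD; ring.
have se d x : esin xi (phi d x) =
    cos (2 * pi * dot2 eta d) * esin eta x - sin (2 * pi * dot2 eta d) * ecos eta x.
  by rewrite /ecos /esin dotphi sinD; ring.
have Ice d : \int[mu]_x ecos xi (phi d x) = cos (2 * pi * dot2 eta d) * \int[mu]_x ecos eta x
    + sin (2 * pi * dot2 eta d) * \int[mu]_x esin eta x.
  rewrite -!RintZl// -RintD; [|exact: bmeasM|exact: bmeasM].
  by apply: eq_Rintegral => x _; exact: ce.
have Ise d : \int[mu]_x esin xi (phi d x) = cos (2 * pi * dot2 eta d) * \int[mu]_x esin eta x
    - sin (2 * pi * dot2 eta d) * \int[mu]_x ecos eta x.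
  rewrite -!RintZl// -RintB; [|exact: bmeasM|exact: bmeasM].
  by apply: eq_Rintegral => x _; exact: se.
rewrite /fourier2 (Rint_invariant (bmeas_ecos xi)) (Rint_invariant (bmeas_esin xi)).
rewrite !Ice !Ise /mask2 /dot2 /= !mulr0 !addr0 !add0r !mulr1 mulr0 cos0 sin0.
ring.
Qed.

Lemma Ainv_add n m (xi : P2) : Ainv n (Ainv m xi) = Ainv (m + n) xi.
Proof. by rewrite /matA_invpow /=; congr pair; rewrite exprD invfM mulrA. Qed.

(* Only necessary conditions: the exact zero set is +-(1/3, 2/3) + Z^2. *)
Definition mask_zeros : set P2 := [set eta | exists k1 k2 : int,
  [/\ 3 * eta.1 = k1%:~R, 3 * eta.2 = k2%:~R, ~~ (3 %| k1)%Z & k2 != 0]].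

Lemma mask2_eq0 eta : mask2 eta = 0 -> mask_zeros eta.
Proof.
rewrite /mask2 => /eqP; rewrite paddr_eq0 ?sqr_ge0// !sqrf_eq0 !mulf_eq0 !invr_eq0.
rewrite (_ : (3 == 0 :> R) = false) /=; last by apply/negbTE.
move=> /andP[/eqP hc /eqP hs]; have [c1 c2] := mask_zero hc hs.
have [k1 [hk1 k13]] := cos_eqN1half c1; have [k2 [hk2 k23]] := cos_eqN1half c2.
exists k1, k2; split => //; apply: contra k23 => /eqP ->; exact: dvdz0.
Qed.

(** On Q both coordinates are at most 5/8 in modulus and 2 pi < 8, so |2 pi <eta, x>| <= 8 * 2 *
    (1/16) * (5/8) < 1: the cosine stays above cos 1 > 0. *)
Lemma fourier2_near0 (eta : P2) : `|eta.1| <= 16^-1 -> `|eta.2| <= 16^-1 -> fourier2 eta != 0.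
Proof.
move=> h1 h2; have c1 := @cos1_gt0 R.
have : cos 1 <= \int[mu]_x ecos eta x.
  rewrite -(Rint_cst mu (cos 1)); apply: Rint_ae_le => //.
  apply: filterS ae_Q => x [Q1 Q2]; apply: cos_ge_cos1.
  have x1 : `|x.1| <= 5/8 by move: Q1; rewrite !ler_norml => /andP[? ?]; apply/andP; split; lra.
  have x2 : `|x.2| <= 5/8 by move: Q2; rewrite !ler_norml => /andP[? ?]; apply/andP; split; lra.
  have pi0 := pi_gt0 R; have pi4 := pihalf_lt2 R.
  rewrite normrM ger0_norm; last by rewrite mulr_ge0// ltW.
  have : `|dot2 eta x| <= 16^-1 * (5/8) + 16^-1 * (5/8).
    apply: le_trans (ler_normD _ _) _; rewrite !normrM.
    by apply: lerD; apply: ler_pM.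
  move=> h; apply: (@le_trans _ _ (2 * 4 * (16^-1 * (5/8) + 16^-1 * (5/8)))); last by lra.
  by apply: ler_pM => //; [rewrite mulr_ge0// ltW|lra].
move=> h; rewrite gt_eqF// ltr_pwDl ?sqr_ge0// exprn_gt0//; exact: lt_le_trans h.
Qed.

Lemma Ainv_small (xi : P2) : exists n, `|(Ainv n xi).1| <= 16^-1 /\ `|(Ainv n xi).2| <= 16^-1.
Proof.
have [n hn] : exists n, 16 * (`|xi.1| + `|xi.2|) <= n%:R :> R.
  by exists (Num.truncn (16 * (`|xi.1| + `|xi.2|))).+1; apply: ltW; exact: truncnS_gt.
have n3 : n%:R <= 3 ^+ n :> R by rewrite -natrX ler_nat ltnW// ltn_expl.
have a1 : 3 ^+ n <= A1 ^+ n by rewrite lerXn2r ?nnegrE ?A1_ge3// ltW.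
have a2 : 3 ^+ n <= A2 ^+ n by rewrite lerXn2r ?nnegrE ?A2_ge3// ltW.
have x1 := normr_ge0 xi.1; have x2 := normr_ge0 xi.2.
exists n; rewrite /matA_invpow /= !normrM !normfV !(ger0_norm (exprn_ge0 _ (ltW _)))//.
by rewrite !ler_pdivrMr ?exprn_gt0//; split; lra.
Qed.

(** By iteration, mu^(xi) is the product of the masks at A^-j xi for 1 <= j <= n and of mu^(A^-n
    xi). For large n the last factor is nonzero, so some mask vanishes. *)
Lemma fourier2_zeros xi : fourier2 xi = 0 ->
  exists2 j, (0 < j)%N & mask_zeros (Ainv j xi).
Proof.
move=> h0; have [n [n1 n2]] := Ainv_small xi.
have : (exists2 j, (0 < j)%N & mask_zeros (Ainv j xi)) \/ fourier2 (Ainv n xi) = 0.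
  elim: n {n1 n2} => [|n [IH|IH]].
  - by right; rewrite /matA_invpow !expr0 !divr1 -surjective_pairing.
  - by left.
  - move: IH; rewrite fourier2_step Ainv_add => /eqP; rewrite mulf_eq0 addn1.
    move=> /orP[/eqP/mask2_eq0 h|/eqP]; last by right.
    by left; exists n.+1.
by case=> // /eqP; rewrite (negbTE (fourier2_near0 n1 n2)).
Qed.

End Invariance.

(** * Counting points in balls and the upper bound *)

Section Cardinality.
Context (R : realType).
Notation P2 := (R * R)%type.

Lemma card_e_le (S : set P2) (K : nat) :
  (forall s : seq P2, uniq s -> (forall x, x \in s -> S x) -> (size s <= K)%N) ->
  (card_e S <= (K%:R)%:E)%E.
Proof.
move=> hS; have fS : finite_set S.
  apply: contrapT => /(infinite_set_fset K.+1)[B BS]; apply/negP; rewrite -leqNgt.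
  by apply: hS (fset_uniq B) _ => x xB; exact: BS.
rewrite /card_e asboolT// lee_fin ler_nat; apply: hS (fset_uniq _) _ => x.
by rewrite in_fset_set// inE.
Qed.

Lemma size_le_card_e (S : set P2) (K : R) (s : seq P2) : (card_e S <= K%:E)%E ->
  uniq s -> (forall x, x \in s -> S x) -> (size s)%:R <= K.
Proof.
rewrite /card_e; case: asboolP => // fS; rewrite lee_fin => hK us sS.
apply: le_trans hK; rewrite ler_nat; apply: uniq_leq_size us _ => x /sS Sx.
by rewrite in_fset_set// inE.
Qed.

Lemma card_e_ge0 (S : set P2) : (0 <= card_e S)%E.
Proof. by rewrite /card_e; case: ifP => _; rewrite ?leey// lee_fin. Qed.

End Cardinality.

Section Counting.
Context (R : realType) (q1 q2 : nat) (hq1 : (1 <= q1)%N) (hq2 : (1 <= q2)%N).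
Notation P2 := (R * R)%type.
Local Notation A1 := (3 * q1%:R : R).
Local Notation A2 := (3 * q2%:R : R).
Local Notation Ainv := (matA_invpow q1 q2).

Let A1_neq0 : A1 != 0. Proof. by rewrite gt_eqF// A1_gt0. Qed.
Let A2_neq0 : A2 != 0. Proof. by rewrite gt_eqF// A2_gt0. Qed.

Definition sub2 (l l' : P2) : P2 := (l.1 - l'.1, l.2 - l'.2).

(* First coordinates lie in one coset of q1 Z; inside a class modulo 3 q1 no
   difference can be killed at level 1, so such a class rescales by A^-1. *)
Lemma count_mask_zeros (n : nat) (s : seq P2) : uniq s ->
  (forall l l', l \in s -> l' \in s -> l <> l' ->
    exists2 j, (0 < j <= n)%N & mask_zeros (Ainv j (sub2 l l'))) ->
  (size s <= 3 ^ n)%N.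
Proof.
elim: n s => [|n IH] s us hs.
  case: s us hs => [|a [|b s]]// /= /andP[].
  rewrite inE negb_or => /andP[/eqP ab _] _ /(_ a b).
  rewrite !inE !eqxx orbT => /(_ isT isT ab)[j] /andP[j0].
  by rewrite leqNgt j0.
case: s us hs => [//|l0 s0].
set s := l0 :: s0 => us hs.
have q10 : q1%:R != 0 :> R by rewrite pnatr_eq0 -lt0n.
(* A difference u at level j + 1 has 3 u.1 = (3 q1)^(j+1) k1, that is u.1 = q1 (3 q1)^j k1. *)
have exz l : exists z : int, l \in s -> l.1 - l0.1 = q1%:R * z%:~R.
  have [ls|] := boolP (l \in s); last by exists 0.
  have [->|/eqP ll0] := eqVneq l l0; first by exists 0; rewrite subrr mulr0.
  have [[//|j] _ [k1 [_ [hk1 _ _ _]]]] := hs l l0 ls (mem_head _ _) ll0.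
  exists ((3 * q1%:Z) ^+ j * k1) => _.
  rewrite intrM rmorphXn /= intrM -hk1 /sub2 /matA_invpow /= exprS.
  have A1j : A1 ^+ j != 0 by rewrite expf_neq0.
  by field; rewrite ?q10 ?A1j.
have [z hz] := choice exz.
pose c l : 'I_3 := inord `|(z l %% 3)%Z|%N.
have cz l l' : c l = c l' -> (3 %| z l - z l')%Z.
  move/(congr1 val); rewrite /c /= !inordK; last 2 first.
  - by rewrite -ltz_nat gez0_abs ?modz_ge0//; exact: ltz_pmod.
  - by rewrite -ltz_nat gez0_abs ?modz_ge0//; exact: ltz_pmod.
  move=> /(congr1 Posz); rewrite !gez0_abs ?modz_ge0// => h.
  by rewrite -eqz_mod_dvd; apply/eqP.
rewrite -sum1_size (partition_big c predT)//=.
apply: (@leq_trans (\sum_(r : 'I_3) 3 ^ n)%N); last by rewrite sum_nat_const card_ord expnS.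
apply: leq_sum => r _; rewrite sum1_count -size_filter.
rewrite -(size_map (Ainv 1)); apply: IH.
  rewrite map_inj_in_uniq ?filter_uniq// => x y _ _ [].
  rewrite !expr1 => /(mulIf (invr_neq0 A1_neq0)) h1 /(mulIf (invr_neq0 A2_neq0)) h2.
  by rewrite (surjective_pairing x) (surjective_pairing y) h1 h2.
move=> _ _ /mapP[l + ->] /mapP[l' + ->]; rewrite !mem_filter.
move=> /andP[/eqP cl ls] /andP[/eqP cl' ls'] nll'.
have ll' : l <> l' by move=> e; apply: nll'; rewrite e.
(* Level 1 would give z l - z l' = k1, not divisible by 3, although both points are in one class; a
   level j + 2 drops to j + 1 after rescaling. *)
have [[|[|j]]//] := hs l l' ls ls' ll'.
  move=> _ [k1 [_ [hk1 _ /negP k13 _]]]; exfalso; apply: k13.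
  have <- : z l - z l' = k1.
    apply: (@intr_inj R); rewrite -hk1 intrB /sub2 /matA_invpow /= expr1.
    have -> : l.1 - l'.1 = q1%:R * (z l)%:~R - q1%:R * (z l')%:~R.
      by rewrite -!hz//; ring.
    by field.
  by apply: cz; rewrite cl cl'.
move=> /= jn mz; exists j.+1 => //.
have -> // : sub2 (Ainv 1 l) (Ainv 1 l') = Ainv 1 (sub2 l l').
  by rewrite /sub2 /matA_invpow /= !expr1 !mulrBl.
by rewrite Ainv_add.
Qed.

Lemma coord2_le_norm2 (u : P2) : `|u.2| <= norm2 u.
Proof.
rewrite /norm2 -sqrtr_sqr; apply: ler_wsqrtr; rewrite lerDr; exact: sqr_ge0.
Qed.

Lemma ball2_coord2 (x y y' : P2) h : ball2 x h y -> ball2 x h y' -> `|y.2 - y'.2| < 2 * h.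
Proof.
rewrite /ball2 /= => h1 h2.
have := le_lt_trans (coord2_le_norm2 _) h1; have := le_lt_trans (coord2_le_norm2 _) h2.
rewrite /= => k2 k1.
have -> : y.2 - y'.2 = (y.2 - x.2) - (y'.2 - x.2) by ring.
apply: le_lt_trans (ler_normB _ _) _; lra.
Qed.

Context (mu : probability P2 R) (hmu : sierpinski_invariant q1 q2 mu).

Lemma orthogonal_count (L : set P2) (x : P2) (h : R) (n : nat) : orthogonal_set mu L ->
  6 * h < A2 ^+ n.+1 -> (card_e (L `&` ball2 x h) <= ((3 ^ n)%N%:R)%:E)%E.
Proof.
move=> [_ oL] hn; apply: card_e_le => s us sL; apply: count_mask_zeros us _.
move=> l l' /sL[Ll Bl] /sL[Ll' Bl'] ll'.
have [oc os] := oL l l' Ll Ll' ll'.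
have f0 : fourier2 mu (sub2 l l') = 0.
  by rewrite /fourier2 /Rintegral oc os /= expr0n addr0.
have [j j0 mz] := fourier2_zeros hmu hq1 hq2 f0.
exists j => //; rewrite j0 /=.
have [k1 [k2 [_ hk2 _ k20]]] := mz.
have A20 := A2_gt0 R hq2; have A2j : 0 < A2 ^+ j by rewrite exprn_gt0.
have k1ge : 1 <= `|k2%:~R| :> R.
  by rewrite -intr_norm -[1]/(1%:~R) ler_int -gtz0_ge1 normr_gt0.
have : A2 ^+ j < A2 ^+ n.+1.
  apply: le_lt_trans hn.
  have := ball2_coord2 Bl Bl'; rewrite -hk2 /sub2 /matA_invpow /= in k1ge *.
  move: k1ge; rewrite !normrM normfV (gtr0_norm A2j) mulrA ler_pdivlMr// mul1r.
  rewrite ger0_norm// => ? ?; lra.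
by rewrite ltr_eXn2l//; apply: lt_le_trans (A2_ge3 R hq2); rewrite ltr1n.
Qed.

Definition sdim : R := ln 3 / ln A2.

Lemma lnA2_gt0 : 0 < ln A2.
Proof. by rewrite ln_gt0//; apply: lt_le_trans (A2_ge3 R hq2); rewrite ltr1n. Qed.

Lemma sdim_gt0 : 0 < sdim.
Proof. by rewrite divr_gt0 ?lnA2_gt0// ln_gt0// ltr1n. Qed.

Lemma A2_powR_sdim : A2 `^ sdim = 3.
Proof.
rewrite /powR (negbTE A2_neq0) /sdim divfK ?lnK ?posrE//.
by rewrite gt_eqF// lnA2_gt0.
Qed.

Lemma pow3_powR n : 3 ^+ n = (A2 ^+ n) `^ sdim.
Proof.
have A20 := ltW (A2_gt0 R hq2).
by rewrite -(powR_mulrn n A20) -powRrM (mulrC n%:R) powRrM A2_powR_sdim powR_mulrn.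
Qed.

(** Take the least [n] with 6 h < A2^(n+1). Then A2^n <= 6 h, by minimality or, for n = 0, because h
    > 1; and 3^n = (A2^n)^sdim. *)
Lemma card_ball_le (L : set P2) (x : P2) (h : R) : orthogonal_set mu L -> 1 < h ->
  (card_e (L `&` ball2 x h) <= ((6 * h) `^ sdim)%:E)%E.
Proof.
move=> oL h1.
have A21 : 1 < A2 by apply: lt_le_trans (A2_ge3 R hq2); rewrite ltr1n.
have ex : exists n, 6 * h < A2 ^+ n.+1.
  have [n hn] : exists n, 6 * h < n%:R.
    by exists (Num.truncn (6 * h)).+1; exact: truncnS_gt.
  exists n; apply: (lt_le_trans hn); apply: (@le_trans _ _ (3 ^+ n.+1)).
    by rewrite -natrX ler_nat ltnW// (leq_trans (ltnSn n))// ltnW// ltn_expl.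
  by rewrite lerXn2r ?nnegrE ?A2_ge3// ltW// A2_gt0.
case: (ex_minnP ex) => n hn nmin.
apply: (le_trans (orthogonal_count x oL hn)); rewrite lee_fin natrX pow3_powR.
have A2n : A2 ^+ n <= 6 * h.
  case: n nmin {hn} => [|n] nmin; first by rewrite expr0; lra.
  by rewrite leNgt; apply/negP => /nmin; rewrite ltnn.
apply: ge0_ler_powR => //; rewrite ?nnegrE ?exprn_ge0//.
- by rewrite ltW// sdim_gt0.
- by lra.
Qed.

Lemma upper_density_ge0 (r : R) (L : set P2) : (0 <= upper_density r L)%E.
Proof.
apply: le_ereal_inf_tmp => _ [M _ <-]; pose h := M + 1.
pose F x := (card_e (L `&` ball2 x h) * ((h `^ r)^-1)%:E)%E.
have F0 x : (0 <= F x)%E.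
  by rewrite mule_ge0// ?card_e_ge0// lee_fin invr_ge0 powR_ge0.
apply: le_trans (F0 (0, 0)) _; apply: (@le_trans _ _ (ereal_sup [set F x | x in [set: P2]])).
  by apply: ereal_sup_ubound; exists (0, 0).
by apply: ereal_sup_ubound; exists h => //=; rewrite ltrDl.
Qed.

Lemma upper_density_eq0 (r : R) (L : set P2) : orthogonal_set mu L -> sdim < r ->
  upper_density r L = 0%E.
Proof.
move=> oL sr; apply/eqP; rewrite eq_le upper_density_ge0 andbT.
apply/lee_addgt0Pr => e e0; rewrite add0e.
(* [M0] solves 6^sdim / h^(r - sdim) = e for h; the maximum with 1 below meets the hypothesis of
   [card_ball_le]. *)
pose b := 6 `^ sdim / e; have b0 : 0 < b by rewrite divr_gt0// powR_gt0.
pose M0 := b `^ (r - sdim)^-1; have M00 : 0 < M0 by rewrite powR_gt0.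
have rs : 0 < r - sdim by rewrite subr_gt0.
apply: (@le_trans _ _ (ereal_sup [set ereal_sup
    [set (card_e (L `&` ball2 x h) * ((h `^ r)^-1)%:E)%E | x in [set: P2]]
    | h in [set h | Num.max 1 M0 < h]])).
  by apply: ereal_inf_lbound; exists (Num.max 1 M0).
apply: ge_ereal_sup => _ [h /= hM <-]; apply: ge_ereal_sup => _ [x _ <-].
move: hM; rewrite gt_max => /andP[h1 hM]; have h0 : 0 < h by lra.
apply: (@le_trans _ _ (((6 * h) `^ sdim)%:E * ((h `^ r)^-1)%:E)%E).
  by apply: lee_wpmul2r; [rewrite lee_fin invr_ge0 powR_ge0|exact: card_ball_le].
rewrite -EFinM lee_fin powRM//; last exact: ltW.
have -> : h `^ r = h `^ sdim * h `^ (r - sdim).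
  by rewrite -powRD ?(gt_eqF h0) ?implybT//; congr powR; ring.
have hs : 0 < h `^ sdim by rewrite powR_gt0.
have hrs : 0 < h `^ (r - sdim) by rewrite powR_gt0.
have -> : 6 `^ sdim * h `^ sdim / (h `^ sdim * h `^ (r - sdim)) = 6 `^ sdim / h `^ (r - sdim).
  by field; rewrite ?gt_eqF.
rewrite ler_pdivrMr// mulrC -ler_pdivrMr// -/b.
have -> : b = M0 `^ (r - sdim).
  by rewrite /M0 -powRrM mulVf ?gt_eqF// powRr1// ltW.
by apply: ge0_ler_powR; rewrite ?nnegrE; exact: ltW.
Qed.

Lemma beurling_dim_le (L : set P2) : orthogonal_set mu L -> (beurling_dim L <= sdim%:E)%E.
Proof.
move=> oL; apply/lee_addgt0Pr => e e0; rewrite -EFinD.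
apply: ereal_inf_lbound; exists (sdim + e) => //; split.
  by rewrite addr_gt0// sdim_gt0.
by apply: upper_density_eq0 => //; rewrite ltrDl.
Qed.

End Counting.

(** * Taylor expansion and Bessel's inequality for clustered frequencies *)

Section FiniteSums.
Context (R : realType).

(** Weighted Cauchy-Schwarz. The coefficients [v] enter the bound only through the majorant [w], so
    one bound serves all points of L. *)
Lemma sqr_sum_le (J : Type) (s : seq J) (v w y : J -> R) : (forall j, `|v j| <= w j) ->
  (\sum_(j <- s) v j * y j) ^+ 2 <=
  (\sum_(j <- s) w j) * (\sum_(j <- s) w j * y j ^+ 2).
Proof.
move=> vw; have w0 j : 0 <= w j by apply: le_trans (vw j).
elim: s => [|j s IH]; first by rewrite !big_nil expr0n mulr0.
rewrite !big_cons; move: IH.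
have := sumr_ge0 _ (fun i (_ : predT i) => w0 i) : 0 <= \sum_(i <- s) w i.
have : 0 <= \sum_(i <- s) w i * y i ^+ 2.
  by apply: sumr_ge0 => i _; rewrite mulr_ge0 ?sqr_ge0.
set S := \sum_(i <- s) v i * y i; set W := \sum_(i <- s) w i.
set B := \sum_(i <- s) w i * y i ^+ 2 => B0 W0 SWB.
(* From S^2 <= W B: 4 S^2 y^2 <= 4 (W y^2) B <= (W y^2 + B)^2. *)
have amgm : 2 * `|S * y j| <= W * y j ^+ 2 + B.
  have r0 : 0 <= W * y j ^+ 2 + B by rewrite addr_ge0// mulr_ge0// sqr_ge0.
  rewrite -ler_sqr ?nnegrE ?mulr_ge0// exprMn real_normK ?num_real// exprMn.
  have : S ^+ 2 * y j ^+ 2 <= W * B * y j ^+ 2 by rewrite ler_wpM2r// sqr_ge0.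
  have := sqr_ge0 (W * y j ^+ 2 - B).
  set Y := y j ^+ 2; set T := S ^+ 2 => h1 h2.
  have -> : (W * Y + B) ^+ 2 = (W * Y - B) ^+ 2 + 4 * (W * B * Y) by ring.
  have -> : 2 ^+ 2 * (T * Y) = 4 * (T * Y) by ring.
  lra.
have cross : 2 * (S * (v j * y j)) <= w j * (W * y j ^+ 2 + B).
  apply: le_trans (ler_norm _) _.
  have -> : `|2 * (S * (v j * y j))| = `|v j| * (2 * `|S * y j|).
    by rewrite !normrM (ger0_norm (ler0n R 2)); ring.
  by apply: ler_pM => //; rewrite mulr_ge0.
have v2 : (v j * y j) ^+ 2 <= w j ^+ 2 * y j ^+ 2.
  rewrite exprMn ler_wpM2r ?sqr_ge0// -(real_normK (num_real (v j))).
  by rewrite lerXn2r// nnegrE.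
have -> : (v j * y j + S) ^+ 2 = S ^+ 2 + 2 * (S * (v j * y j)) + (v j * y j) ^+ 2 by ring.
have -> : (w j + W) * (w j * y j ^+ 2 + B) =
  W * B + w j * (W * y j ^+ 2 + B) + w j ^+ 2 * y j ^+ 2 by ring.
lra.
Qed.

Lemma ler_sum_subseq (J : eqType) (s s' : seq J) (F : J -> R) : uniq s -> uniq s' ->
  {subset s <= s'} -> (forall j, 0 <= F j) -> \sum_(j <- s) F j <= \sum_(j <- s') F j.
Proof.
move=> us us' ss F0.
have /(perm_big _) -> : perm_eq s [seq j <- s' | j \in s].
  apply: uniq_perm => //; first exact: filter_uniq.
  by move=> j; rewrite mem_filter; apply/idP/andP => [js|[]//]; split=> //; exact: ss.
rewrite big_filter big_mkcond; apply: ler_sum => j _.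
by case: ifP.
Qed.

(** Bessel sums run over distinct frequencies, while [tau] may repeat them: grouping by value costs
    the multiplicity bound [K]. *)
Lemma sum_fibers (J I : eqType) (s : seq J) (tau : J -> I) (F : I -> R) (K : R) :
  (forall i, 0 <= F i) -> (forall i, (count (fun j => tau j == i) s)%:R <= K) ->
  \sum_(j <- s) F (tau j) <= K * \sum_(i <- undup (map tau s)) F i.
Proof.
move=> F0 hK; rewrite -(big_map tau predT F) -big_undup_iterop_count mulr_sumr.
apply: ler_sum => i _; rewrite -/(GRing.natmul _ _) -mulr_natl.
apply: ler_wpM2r => //; rewrite count_map; exact: hK.
Qed.

Lemma sum_exp_coeff_le (x : R) n : 0 <= x ->
  \sum_(k <- iota 0 n) x ^+ k / k`!%:R <= expR x.
Proof.
move=> x0.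
have := @nondecreasing_cvgn_le R (series (exp_coeff x)) _ (is_cvg_series_exp_coeff x) n.
rewrite /expR /series /= /index_iota subn0; apply.
move=> m k mk; apply: nondecreasing_series => // i _ _.
exact: exp_coeff_ge0.
Qed.

End FiniteSums.

Lemma Rint_dominated_cvg d (T : measurableType d) (R : realType) (mu : probability T R)
    (f_ : nat -> T -> R) (f : T -> R) (M : R) :
  (forall n, bmeas (f_ n)) -> bmeas f -> (forall n x, `|f_ n x| <= M) ->
  (forall x, f_ ^~ x @ \oo --> f x) ->
  (fun n => \int[mu]_x f_ n x) @ \oo --> \int[mu]_x f x.
Proof.
move=> bf_ bf fM cf.
have bM : bmeas (fun _ : T => M) by exact: bmeas_cst.
have h : ((\int[mu]_x (f_ n x)%:E)%E @[n \oo] --> (\int[mu]_x (f x)%:E)%E).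
  apply: (@dominated_cvg _ _ _ mu _ _ _ _ (EFin \o (fun _ : T => M))) => //.
  - by move=> n; apply/measurable_EFinP; exact: (bf_ n).1.
  - by move=> x _; apply: cvg_EFin; [exact: nearW|exact: cf].
  - exact: bmeas_integrable.
  - by move=> n x _; rewrite lee_fin; exact: fM.
rewrite Rintegral_EFin// in h.
exact: fine_cvg h.
Qed.

Section Expansion.
Context (R : realType) (mu : probability (R * R)%type R).
Notation P2 := (R * R)%type.
Local Hint Resolve bmeas_ecos bmeas_esin : core.

(* squared modulus of the Fourier coefficient of g at gamma *)
Definition coef2 (g : P2 -> R) (gamma : P2) : R :=
  (\int[mu]_x (g x * ecos gamma x)) ^+ 2 + (\int[mu]_x (g x * esin gamma x)) ^+ 2.

Lemma coef2_ge0 g gamma : 0 <= coef2 g gamma.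
Proof. by rewrite addr_ge0// sqr_ge0. Qed.

Lemma coef2_sum (J : Type) (s : seq J) (v w : J -> R) (g : J -> P2 -> R) gamma :
  (forall j, bmeas (g j)) -> (forall j, `|v j| <= w j) ->
  coef2 (fun x => \sum_(j <- s) v j * g j x) gamma <=
  (\sum_(j <- s) w j) * \sum_(j <- s) w j * coef2 (g j) gamma.
Proof.
move=> bg vw.
have E (e : P2 -> R) : bmeas e -> \int[mu]_x ((\sum_(j <- s) v j * g j x) * e x) =
    \sum_(j <- s) v j * \int[mu]_x (g j x * e x).
  move=> be; rewrite (eq_bigr (fun j => \int[mu]_x (v j * (g j x * e x)))); last first.
    by move=> j _; rewrite RintZl//; exact: bmeasM.
  rewrite -Rint_sum; last by move=> j; apply: bmeasM => //; exact: bmeasM.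
  by apply: eq_Rintegral => x _; rewrite mulr_suml; apply: eq_bigr => j _; rewrite mulrA.
rewrite /coef2 !E//; under [X in _ <= _ * X]eq_bigr do rewrite mulrDr.
by rewrite big_split mulrDr; apply: lerD; exact: sqr_sum_le.
Qed.

(** The first index is the total degree, the second the exponent of [x.2]. The cutoff bounds the
    function by 1 and is invisible to a measure carried by Q. *)
Definition monomial (j : nat * nat) (x : P2) : R :=
  \1_(@Q R) x * (x.1 ^+ (j.1 - j.2) * x.2 ^+ j.2).

Lemma Q_le1 (x : P2) : Q x -> `|x.1| <= 1 /\ `|x.2| <= 1.
Proof. by rewrite /Q /= !ler_norml; move=> [/andP[? ?] /andP[? ?]]; split; apply/andP; split; lra. Qed.

Lemma monomial_le1 j x : `|monomial j x| <= 1.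
Proof.
rewrite /monomial indicE; case: (boolP (x \in _)) => [|_]; last by rewrite mul0r normr0.
rewrite inE => /Q_le1[x1 x2]; rewrite mul1r normrM !normrX.
by rewrite mulr_ile1// exprn_ile1.
Qed.

Lemma bmeas_monomial j : bmeas (monomial j).
Proof.
split; last by exists 1; exact: monomial_le1.
apply: measurable_funM; first exact: (bmeas_indicQ R).1.
by apply: measurable_funM; apply: measurable_funX.
Qed.
Local Hint Resolve bmeas_monomial : core.

Definition pairs n : seq (nat * nat) := [seq (k, i) | k <- iota 0 n, i <- iota 0 k.+1].

(** Majorant of the Taylor coefficient of rho(2 pi <z, x>) at [monomial j] when both coordinates of
    z are at most C in modulus. In degree k the binomials sum to 2^k, hence the total e^(4 pi C). *)
Definition weight (C : R) (j : nat * nat) : R :=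
  (2 * pi * C) ^+ j.1 * 'C(j.1, j.2)%:R / j.1`!%:R.

Lemma sum_weight (C : R) n : 0 <= C ->
  \sum_(j <- pairs n) weight C j <= expR (4 * pi * C).
Proof.
move=> C0; rewrite /pairs big_allpairs_dep /=.
have c0 : 0 <= 4 * pi * C by rewrite !mulr_ge0// pi_ge0.
apply: le_trans (sum_exp_coeff_le n c0); rewrite le_eqVlt; apply/orP; left; apply/eqP.
apply: eq_bigr => k _; rewrite /weight /= -mulr_suml -mulr_sumr; congr (_ / _).
have -> : \sum_(i <- iota 0 k.+1) 'C(k, i)%:R = 2 ^+ k :> R.
  have := exprDn (1 : R) 1 k; rewrite -[1 + 1]/(2%:R) => ->.
  rewrite -[iota 0 k.+1]/(index_iota 0 k.+1) big_mkord; apply: eq_bigr => i _.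
  by rewrite !expr1n mulr1.
by rewrite -exprMn; congr (_ ^+ _); ring.
Qed.

Lemma expand_power (z x : P2) (c : R) k :
  \1_(@Q R) x * (c * (2 * pi * dot2 z x) ^+ k / k`!%:R) =
  \sum_(i <- iota 0 k.+1) (c * (2 * pi) ^+ k * (z.1 ^+ (k - i) * z.2 ^+ i) * 'C(k, i)%:R / k`!%:R)
    * monomial (k, i) x.
Proof.
rewrite -[iota 0 k.+1]/(index_iota 0 k.+1) big_mkord /dot2 exprMn exprDn.
rewrite !(mulr_sumr, mulr_suml); apply: eq_bigr => i _.
by rewrite /monomial /= -mulr_natr !exprMn; ring.
Qed.

(* rho stands for cos or sin, c for the signs of its Taylor coefficients *)
Lemma taylor_cluster (rho : R -> R) (c : nat -> R) (C K : R)
    (t : seq P2) (tau z : P2 -> P2) :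
  0 <= C -> (forall k, `|c k| <= 1) ->
  (forall u, (fun n => \sum_(k <- iota 0 n) c k * u ^+ k / k`!%:R) @ \oo --> rho u) ->
  (forall zeta : P2, bmeas (fun x => rho (2 * pi * dot2 zeta x))) ->
  {ae mu, forall x, Q x} ->
  (forall l, l \in t -> `|(z l).1| <= C /\ `|(z l).2| <= C) ->
  (forall g (s : seq P2), bmeas g -> uniq s -> {subset s <= map tau t} ->
     \sum_(gamma <- s) coef2 g gamma <= \int[mu]_x (g x * g x)) ->
  (forall gamma, (count (fun l => tau l == gamma) t)%:R <= K) ->
  \sum_(l <- t) coef2 (fun x => rho (2 * pi * dot2 (z l) x)) (tau l)
    <= expR (4 * pi * C) ^+ 2 * K.
Proof.
move=> C0 c1 crho brho aeQ hz bess hK.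
have K0 : 0 <= K by apply: le_trans (hK (0, 0)).
pose E := expR (4 * pi * C); have E0 : 0 < E by exact: expR_gt0.
pose v l (j : nat * nat) := c j.1 * (2 * pi) ^+ j.1 * ((z l).1 ^+ (j.1 - j.2) * (z l).2 ^+ j.2)
   * 'C(j.1, j.2)%:R / j.1`!%:R.
pose T n l x := \sum_(j <- pairs n) v l j * monomial j x.
have w0 j : 0 <= weight C j.
  by rewrite /weight !mulr_ge0 ?invr_ge0// exprn_ge0// !mulr_ge0// pi_ge0.
have sw0 n : 0 <= \sum_(j <- pairs n) weight C j by apply: sumr_ge0.
have vw l j : l \in t -> `|v l j| <= weight C j.
  move=> lt; have [z1 z2] := hz l lt; rewrite /v /weight.
  (* For i > k the truncated exponent k - i is 0 and the estimate by C^k need not hold, but the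
     binomial coefficient vanishes. *)
  case: j => k i /=; have [ik|ki] := leqP i k; last first.
    by rewrite bin_small// !mulr0 !mul0r normr0.
  have zz : `|(z l).1 ^+ (k - i) * (z l).2 ^+ i| <= C ^+ k.
    rewrite -[in leRHS](subnK ik) exprD normrM !normrX.
    by apply: ler_pM; rewrite ?exprn_ge0// lerXn2r// nnegrE.
  have p0 : 0 <= 2 * pi :> R by rewrite mulr_ge0// pi_ge0.
  rewrite !normrM normfV !normr_nat normrX (ger0_norm p0) [in leRHS]exprMn.
  rewrite ler_wpM2r ?invr_ge0// ler_wpM2r//.
  rewrite -normrM -[leRHS]mul1r -mulrA; apply: ler_pM => //.
    by rewrite mulr_ge0// exprn_ge0.
  by rewrite ler_wpM2l// exprn_ge0.
have bT n l : bmeas (T n l) by apply: bmeas_sum => j; exact: bmeasM.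
have TE n l x : T n l x = \1_(@Q R) x *
    \sum_(k <- iota 0 n) c k * (2 * pi * dot2 (z l) x) ^+ k / k`!%:R.
  rewrite /T /pairs big_allpairs_dep mulr_sumr; apply: eq_bigr => k _.
  by rewrite expand_power.
have Tle n l x : l \in t -> `|T n l x| <= E.
  move=> lt; apply: le_trans (sum_weight n C0).
  apply: le_trans (ler_norm_sum _ _ _) _; apply: ler_sum => j _.
  by rewrite normrM -[leRHS]mulr1; apply: ler_pM => //; [exact: vw|exact: monomial_le1].
(* First for Taylor truncations: after exchanging the sums, each monomial contributes a Bessel sum
   over the values of [tau], at most 1, times [K]. The bound is uniform in [n] and passes to the
   limit. *)
have step n : \sum_(l <- t) coef2 (T n l) (tau l) <= E ^+ 2 * K.
  apply: (@le_trans _ _ (\sum_(l <- t) E * \sum_(j <- pairs n) weight C j * coef2 (monomial j) (tau l))).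
    rewrite big_seq [leRHS]big_seq; apply: ler_sum => l lt.
    apply: le_trans (coef2_sum _ _ bmeas_monomial (fun j => vw l j lt)) _.
    apply: ler_wpM2r; last exact: sum_weight.
    by apply: sumr_ge0 => j _; rewrite mulr_ge0// coef2_ge0.
  rewrite -mulr_sumr exchange_big /= expr2 -mulrA ler_wpM2l//; first exact: ltW.
  apply: (@le_trans _ _ (\sum_(j <- pairs n) weight C j * K)); last first.
    by rewrite -mulr_suml ler_wpM2r//; exact: sum_weight.
  apply: ler_sum => j _; rewrite -mulr_sumr ler_wpM2l//.
  apply: le_trans (sum_fibers (coef2_ge0 (monomial j)) hK) _.
  rewrite -[leRHS]mulr1 ler_wpM2l//.
  apply: (@le_trans _ _ (\int[mu]_x (monomial j x * monomial j x))).
    apply: bess => //; first exact: undup_uniq.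
    by move=> g; rewrite mem_undup.
  rewrite -[leRHS](Rint_cst mu 1); apply: Rint_le => //; first exact: bmeasM.
  move=> x; apply: le_trans (ler_norm _) _; rewrite normrM.
  by apply: mulr_ile1 => //; exact: monomial_le1.
have lim l (e : P2 -> R) : l \in t -> bmeas e ->
    (fun n => \int[mu]_x (T n l x * e x)) @ \oo -->
    \int[mu]_x (rho (2 * pi * dot2 (z l) x) * e x).
  move=> lt be; have [me [Me hMe]] := be.
  have bQ := bmeas_indicQ R.
  have -> : \int[mu]_x (rho (2 * pi * dot2 (z l) x) * e x) =
      \int[mu]_x (\1_(@Q R) x * rho (2 * pi * dot2 (z l) x) * e x).
    apply: Rint_ae_eq; [exact: bmeasM| |].
      by apply: bmeasM => //; apply: bmeasM.
    by apply: filterS aeQ => x Qx; rewrite indicE mem_set// mul1r.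
  apply: (@Rint_dominated_cvg _ _ _ _ _ _ (E * Me)).
  - by move=> n; exact: bmeasM.
  - by apply: bmeasM => //; apply: bmeasM.
  - by move=> n x; rewrite normrM; apply: ler_pM => //; exact: Tle.
  - move=> x; apply: cvgM; last exact: cvg_cst.
    rewrite (_ : (fun n => T n l x) = (fun n => \1_(@Q R) x *
      \sum_(k <- iota 0 n) c k * (2 * pi * dot2 (z l) x) ^+ k / k`!%:R)).
      by apply: cvgM; [exact: cvg_cst|exact: crho].
    by apply/funext => n; exact: TE.
have cv : (fun n => \sum_(l <- t | l \in t) coef2 (T n l) (tau l)) @ \oo -->
    \sum_(l <- t | l \in t) coef2 (fun x => rho (2 * pi * dot2 (z l) x)) (tau l).
  apply: cvg_big; first exact: add_continuous.
  move=> l lt; rewrite /coef2; apply: cvgD; rewrite expr2; under eq_fun do rewrite expr2.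
    by apply: cvgM; apply: lim.
  by apply: cvgM; apply: lim.
rewrite big_seq -(cvg_lim (@Rhausdorff R) cv); apply: limr_le.
  by apply/cvg_ex; eexists; exact: cv.
by apply: nearW => n; rewrite -big_seq; exact: step.
Qed.

Lemma cos_series (u : R) : (fun n => \sum_(k <- iota 0 n)
  ((~~ odd k)%:R * (-1) ^+ k./2) * u ^+ k / k`!%:R) @ \oo --> cos u.
Proof.
have h : series (cos_coeff u) @ \oo --> cos u.
  by rewrite cos.unlock; exact: is_cvg_series_cos_coeff.
rewrite (_ : (fun n => _) = series (cos_coeff u))//; apply/funext => n.
by rewrite /series /= /index_iota subn0.
Qed.

Lemma sin_series (u : R) : (fun n => \sum_(k <- iota 0 n)
  ((odd k)%:R * (-1) ^+ k.-1./2) * u ^+ k / k`!%:R) @ \oo --> sin u.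
Proof.
have h : series (sin_coeff u) @ \oo --> sin u.
  by rewrite sin.unlock; exact: is_cvg_series_sin_coeff.
rewrite (_ : (fun n => _) = series (sin_coeff u))//; apply/funext => n.
by rewrite /series /= /index_iota subn0.
Qed.

(** Factor e(<tau + z, x>) as e(<z, x>) e(<tau, x>) and treat the cosine and the sine of <z, x>
    separately; |a + b|^2 <= 2 |a|^2 + 2 |b|^2 gives 4 = 2 + 2. *)
Lemma fourier2_cluster (C K : R) (t : seq P2) (tau z : P2 -> P2) :
  0 <= C -> {ae mu, forall x, Q x} ->
  (forall l, l \in t -> `|(z l).1| <= C /\ `|(z l).2| <= C) ->
  (forall g (s : seq P2), bmeas g -> uniq s -> {subset s <= map tau t} ->
     \sum_(gamma <- s) coef2 g gamma <= \int[mu]_x (g x * g x)) ->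
  (forall gamma, (count (fun l => tau l == gamma) t)%:R <= K) ->
  \sum_(l <- t) fourier2 mu ((tau l).1 + (z l).1, (tau l).2 + (z l).2)
    <= 4 * expR (4 * pi * C) ^+ 2 * K.
Proof.
move=> C0 aeQ hz bess hK.
have mdot (zeta : P2) : measurable_fun setT (fun x => 2 * pi * dot2 zeta x).
  by apply: measurable_funM => //; exact: measurable_dot2.
have sgn (b : bool) k : `|b%:R * (-1) ^+ k| <= 1 :> R.
  by rewrite normrM normrX normrN normr1 expr1n mulr1 normr_nat; case: b.
have hc := taylor_cluster C0 (fun k => sgn _ _) cos_series
  (fun zeta => bmeas_cos (mdot zeta)) aeQ hz bess hK.
have hs := taylor_cluster C0 (fun k => sgn _ _) sin_series
  (fun zeta => bmeas_sin (mdot zeta)) aeQ hz bess hK.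
set c2 := (X in X <= _) in hc; set s2 := (X in X <= _) in hs.
apply: (@le_trans _ _ (2 * c2 + 2 * s2)); last by lra.
rewrite /c2 /s2 !mulr_sumr -big_split /=; apply: ler_sum => l _.
set g := tau l; set w := z l.
have bc := bmeas_cos (mdot w); have bs := bmeas_sin (mdot w).
have bcc := bmeasM bc (bmeas_ecos g); have bcs := bmeasM bc (bmeas_esin g).
have bsc := bmeasM bs (bmeas_ecos g); have bss := bmeasM bs (bmeas_esin g).
have dotD x : 2 * pi * dot2 (g.1 + w.1, g.2 + w.2) x =
    2 * pi * dot2 w x + 2 * pi * dot2 g x by rewrite /dot2 /=; ring.
rewrite /fourier2 /coef2.
have -> : \int[mu]_x ecos (g.1 + w.1, g.2 + w.2) x =
    \int[mu]_x (cos (2 * pi * dot2 w x) * ecos g x)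
    + \int[mu]_x (sin (2 * pi * dot2 w x) * esin g x).
  rewrite -RintD//.
  by apply: eq_Rintegral => x _; rewrite /ecos /esin dotD cosD; ring.
have -> : \int[mu]_x esin (g.1 + w.1, g.2 + w.2) x =
    \int[mu]_x (cos (2 * pi * dot2 w x) * esin g x)
    - \int[mu]_x (sin (2 * pi * dot2 w x) * ecos g x).
  rewrite -RintB//.
  by apply: eq_Rintegral => x _; rewrite /ecos /esin dotD sinD; ring.
set a1 := \int[mu]_x _; set a2 := \int[mu]_x _; set a3 := \int[mu]_x _; set a4 := \int[mu]_x _.
rewrite -subr_ge0.
have -> : 2 * (a1 ^+ 2 + a3 ^+ 2) + 2 * (a4 ^+ 2 + a2 ^+ 2) - ((a1 + a2) ^+ 2 + (a3 - a4) ^+ 2)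
   = (a1 - a2) ^+ 2 + (a3 + a4) ^+ 2 by ring.
by rewrite addr_ge0// sqr_ge0.
Qed.

End Expansion.

(** * Spectra and the lower bound *)

Section Spectra.
Context (R : realType) (mu : probability (R * R)%type R).
Notation P2 := (R * R)%type.
Local Hint Resolve bmeas_ecos bmeas_esin : core.

(* real and imaginary parts of e_l (false) and of i e_l (true) *)
Definition re_exp (i : P2 * bool) : P2 -> R :=
  if i.2 then fun x => - esin i.1 x else ecos i.1.
Definition im_exp (i : P2 * bool) : P2 -> R :=
  if i.2 then ecos i.1 else esin i.1.

Lemma bmeas_re_exp i : bmeas (re_exp i).
Proof. by rewrite /re_exp; case: i.2 => //; exact: bmeasN. Qed.

Lemma bmeas_im_exp i : bmeas (im_exp i).
Proof. by rewrite /im_exp; case: i.2. Qed.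

(** For distinct frequencies the four cases are, up to sign, the real and imaginary parts of mu^(l -
    l'). *)
Lemma exp_orthonormal (L : set P2) : orthogonal_set mu L -> forall i j, L i.1 -> L j.1 ->
  ip mu (re_exp i) (im_exp i) (re_exp j) (im_exp j) = (i == j)%:R.
Proof.
move=> [_ oL] [l b] [l' b'] /= Ll Ll'.
have [<-|/eqP ll'] := eqVneq l l'.
  have -> : (((l, b) == (l, b')) = (b == b')) by rewrite xpair_eqE eqxx.
  rewrite -[RHS](Rint_cst mu); apply: eq_Rintegral => x _.
  have := cos2Dsin2 (2 * pi * dot2 l x).
  by case: b; case: b'; rewrite /re_exp /im_exp /ecos /esin /=;
    move: (cos _) (sin _) => u v uv;
    first [ring | transitivity (u ^+ 2 + v ^+ 2); [ring|exact: uv]].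
have -> : ((l, b) == (l', b')) = false.
  by apply/negbTE; rewrite xpair_eqE negb_and; apply/orP; left; exact/eqP.
have [oc os] := oL l l' Ll Ll' ll'.
have Ic : \int[mu]_x ecos (l.1 - l'.1, l.2 - l'.2) x = 0 by rewrite /Rintegral oc.
have Is : \int[mu]_x esin (l.1 - l'.1, l.2 - l'.2) x = 0 by rewrite /Rintegral os.
have dotB x : 2 * pi * dot2 (l.1 - l'.1, l.2 - l'.2) x =
    2 * pi * dot2 l x - 2 * pi * dot2 l' x by rewrite /dot2 /=; ring.
have Ins : \int[mu]_x (- esin (l.1 - l'.1, l.2 - l'.2) x) = 0.
  by rewrite (@RintN _ _ _ mu _ (bmeas_esin _)) Is oppr0.
rewrite /re_exp /im_exp; case: b; case: b' => /=.
- by rewrite -[RHS]Ic; apply: eq_Rintegral => x _; rewrite /ecos /esin dotB cosB; ring.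
- by rewrite -[RHS]Ins; apply: eq_Rintegral => x _; rewrite /ecos /esin dotB sinB; ring.
- by rewrite -[RHS]Is; apply: eq_Rintegral => x _; rewrite /ecos /esin dotB sinB; ring.
- by rewrite -[RHS]Ic; apply: eq_Rintegral => x _; rewrite /ecos /esin dotB cosB; ring.
Qed.

Lemma ip_exp_false (g : P2 -> R) l : bmeas g ->
  ip mu g (fun=> 0) (re_exp (l, false)) (im_exp (l, false)) = \int[mu]_x (g x * ecos l x).
Proof.
by move=> bg; apply: eq_Rintegral => x _; rewrite /re_exp /im_exp /= mul0r addr0.
Qed.

Lemma ip_exp_true (g : P2 -> R) l : bmeas g ->
  ip mu g (fun=> 0) (re_exp (l, true)) (im_exp (l, true)) = - \int[mu]_x (g x * esin l x).
Proof.
move=> bg; have bge := bmeasM bg (bmeas_esin l); rewrite -RintN//.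
by apply: eq_Rintegral => x _; rewrite /re_exp /im_exp /= mul0r addr0 mulrN.
Qed.

Lemma sum_ip_exp (g : P2 -> R) (s : seq P2) : bmeas g ->
  \sum_(i <- [seq (l, b) | l <- s, b <- [:: false; true]])
    ip mu g (fun=> 0) (re_exp i) (im_exp i) ^+ 2 = \sum_(l <- s) coef2 mu g l.
Proof.
move=> bg; rewrite big_allpairs; apply: eq_bigr => l _.
by rewrite 2!big_cons big_nil /= addr0 ip_exp_false// ip_exp_true// sqrrN.
Qed.

Lemma uniq_pairs_bool (s : seq P2) : uniq s -> uniq [seq (l, b) | l <- s, b <- [:: false; true]].
Proof. by move=> us; apply: allpairs_uniq => // -[? ?] [? ?] _ _. Qed.

Lemma bessel_coef2 (L : set P2) (g : P2 -> R) (s : seq P2) : orthogonal_set mu L ->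
  bmeas g -> uniq s -> (forall l, l \in s -> L l) ->
  \sum_(l <- s) coef2 mu g l <= \int[mu]_x (g x * g x).
Proof.
move=> oL bg us sL; rewrite -sum_ip_exp//.
have -> : \int[mu]_x (g x * g x) = ip mu g (fun=> 0) g (fun=> 0).
  by apply: eq_Rintegral => x _; rewrite mulr0 addr0.
apply: (@bessel _ _ _ mu _ re_exp im_exp [set i | L i.1]) => //.
- exact: bmeas_re_exp.
- exact: bmeas_im_exp.
- exact: exp_orthonormal oL.
- exact: uniq_pairs_bool.
- by move=> i /allpairsP[[l b] /= [ls _ ->]]; exact: sL.
Qed.

Lemma parseval_coef2 (L : set P2) (g : P2 -> R) (eps : R) : spectrum mu L ->
  bmeas g -> 0 < eps -> exists t : seq P2, [/\ uniq t, forall l, l \in t -> L l &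
    \int[mu]_x (g x * g x) - eps <= \sum_(l <- t) coef2 mu g l].
Proof.
move=> [oL cL] bg eps0.
have cA : countable [set i : P2 * bool | L i.1].
  have -> : [set i : P2 * bool | L i.1] = L `*` [set: bool].
    by apply/seteqP; split => -[l b] //= [].
  by apply: countableX; [exact: oL.1|exact: countableP].
have b0 : bmeas (fun _ : P2 => 0 : R) by exact: bmeas_cst.
have complete : forall u v : P2 -> R,
  measurable_fun setT u -> measurable_fun setT v ->
  (\int[mu]_x (u x ^+ 2)%:E < +oo)%E -> (\int[mu]_x (v x ^+ 2)%:E < +oo)%E ->
  (forall i, [set i | L i.1] i ->
    (\int[mu]_x (u x * re_exp i x + v x * im_exp i x)%:E = 0)%E) ->
  {ae mu, forall x, u x = 0 /\ v x = 0}.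
  move=> u v meas_u meas_v u2 v2 h; apply: cL => // l Ll; split.
    exact: (h (l, false) Ll).
  rewrite -(h (l, true) Ll); apply: eq_integral => x _; congr EFin.
  by rewrite /re_exp /im_exp /=; ring.
have [s [us sL hs]] := parseval bmeas_re_exp bmeas_im_exp (exp_orthonormal oL)
  bg b0 cA complete eps0.
(* [s] may hold only one of e_l and i e_l; passing to its frequencies restores both and can only
   enlarge the sum. *)
exists (undup (map fst s)); split; first exact: undup_uniq.
  by move=> l; rewrite mem_undup => /mapP[i /sL Li ->].
have e : \int[mu]_x (g x * g x) = ip mu g (fun=> 0) g (fun=> 0).
  by apply: eq_Rintegral => x _; rewrite mulr0 addr0.
rewrite e; apply: (le_trans hs); rewrite -sum_ip_exp//.
apply: ler_sum_subseq => //.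
- by apply: uniq_pairs_bool; exact: undup_uniq.
- move=> [l b] si; apply/allpairsP; exists (l, b); split => //=.
    by rewrite mem_undup; apply/mapP; exists (l, b).
  by rewrite !inE; case: (b).
- by move=> i; exact: sqr_ge0.
Qed.

Context (q1 q2 : nat) (hq1 : (1 <= q1)%N) (hq12 : (q1 <= q2)%N).
Context (hmu : sierpinski_invariant q1 q2 mu).
Local Notation A1 := (3 * q1%:R : R).
Local Notation A2 := (3 * q2%:R : R).
Local Notation Ainv := (matA_invpow q1 q2).
Let hq2 : (1 <= q2)%N := leq_trans hq1 hq12.

(* Parseval for the indicator of the cylinder A^-N Q, of measure 3^-N. *)
Lemma spectrum_mass (L : set P2) (N : nat) : spectrum mu L ->
  exists t : seq P2, [/\ uniq t, forall l, l \in t -> L l &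
    3 ^+ N / 2 <= \sum_(l <- t) fourier2 mu (Ainv N l)].
Proof.
move=> sL; pose g x := \1_(@Q R) (matApow q1 q2 N x) : R.
have bg : bmeas g.
  apply: (@bmeas_comp _ (fun x => \1_(@Q R) x : R) (matApow q1 q2 N)).
    exact: bmeas_indicQ.
  exact: measurable_matApow.
have p3 : 0 < 3^-1 ^+ N :> R by rewrite exprn_gt0// invr_gt0.
(* With eps half of the mass 3^-N, a finite list keeps half of the Parseval sum; dividing by 3^-2N
   leaves 3^N / 2. *)
have [t [ut tL ht]] := parseval_coef2 sL bg (divr_gt0 p3 (ltr0n R 2)).
exists t; split => //.
have b1 : bmeas (fun _ : P2 => 1 : R) by exact: bmeas_cst.
have gg : \int[mu]_x (g x * g x) = 3^-1 ^+ N.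
  have := Rint_cylinder hmu hq1 hq2 N b1; rewrite Rint_cst mulr1 => <-.
  apply: eq_Rintegral => x _; rewrite mulr1 /g indicE.
  by case: (_ \in _); rewrite ?mulr1 ?mulr0.
have a1 : A1 ^+ N != 0 by rewrite expf_neq0// gt_eqF// A1_gt0.
have a2 : A2 ^+ N != 0 by rewrite expf_neq0// gt_eqF// A2_gt0.
have dotA (l x : P2) : dot2 (Ainv N l) (matApow q1 q2 N x) = dot2 l x.
  by rewrite /dot2 /matA_invpow /matApow /= !mulrA !divfK.
have cg l : coef2 mu g l = (3^-1 ^+ N) ^+ 2 * fourier2 mu (Ainv N l).
  rewrite /coef2 /fourier2 mulrDr -!exprMn.
  rewrite -(Rint_cylinder hmu hq1 hq2 N (bmeas_ecos (Ainv N l))).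
  rewrite -(Rint_cylinder hmu hq1 hq2 N (bmeas_esin (Ainv N l))).
  by congr (_ ^+ 2 + _ ^+ 2); apply: eq_Rintegral => x _; rewrite /ecos /esin dotA.
move: ht; rewrite gg (eq_bigr _ (fun l _ => cg l)) -mulr_sumr.
set S := \sum_(l <- t) _ => ht.
have e3 : 3^-1 ^+ N * 3 ^+ N = 1 :> R by rewrite -exprMn mulVf ?expr1n.
have : 3^-1 ^+ N / 2 <= 3^-1 ^+ N * (3^-1 ^+ N * S) by move: ht; rewrite expr2 mulrA; lra.
rewrite ler_pM2l// -(ler_pM2l (exprn_gt0 N (ltr0n R 3))).
by rewrite [X in _ <= X -> _]mulrA [X in X * S]mulrC e3 mul1r.
Qed.

Lemma coord1_le_norm2 (u : P2) : `|u.1| <= norm2 u.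
Proof.
rewrite /norm2 -sqrtr_sqr; apply: ler_wsqrtr; rewrite lerDl; exact: sqr_ge0.
Qed.

(** Errors do not accumulate: A^-p shrinks an old error 2 C to at most C, and passing to a new point
    of L adds at most C. *)
Lemma near_iterate (L : set P2) (p : nat) (C : R) : (1 <= p)%N -> 0 <= C ->
  (forall l, L l -> exists2 g, L g & norm2 (sub2 (Ainv p l) g) <= C) ->
  forall n l, L l -> exists2 g, L g &
    `|(sub2 (Ainv (p * n) l) g).1| <= 2 * C /\ `|(sub2 (Ainv (p * n) l) g).2| <= 2 * C.
Proof.
move=> p1 C0 hL; elim=> [|n IH] l Ll.
  exists l => //; rewrite muln0 /sub2 /matA_invpow /= !expr0 !divr1 !subrr normr0.
  by split; lra.
have [g Lg [g1 g2]] := IH l Ll; have [g' Lg' hg'] := hL g Lg.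
exists g' => //; rewrite mulnS addnC -Ainv_add.
have h1 := le_trans (coord1_le_norm2 _) hg'; have h2 := le_trans (coord2_le_norm2 _) hg'.
have key (a u w w' : R) : 3 <= a -> `|u - w| <= 2 * C -> `|w / a ^+ p - w'| <= C ->
    `|u / a ^+ p - w'| <= 2 * C.
  move=> a3 h k.
  have ap : 3 <= a ^+ p.
    case: (p) p1 => // m _; rewrite exprS -[3]mulr1; apply: ler_pM => //.
    by rewrite exprn_ege1//; lra.
  have ap0 : 0 < a ^+ p by lra.
  have -> : u / a ^+ p - w' = (u - w) / a ^+ p + (w / a ^+ p - w') by ring.
  apply: le_trans (ler_normD _ _) _; rewrite normrM normfV (gtr0_norm ap0).
  have : `|u - w| / a ^+ p <= C.
    rewrite ler_pdivrMr//; apply: (le_trans h).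
    by rewrite mulrC ler_wpM2l//; lra.
  by lra.
split; [apply: key (A1_ge3 R hq1) g1 h1|apply: key (A2_ge3 R hq2) g2 h2].
Qed.

Lemma norm2_lt (u : P2) (h : R) : 0 < h -> `|u.1| <= h -> `|u.2| <= h -> norm2 u < 2 * h.
Proof.
move=> h0 u1 u2.
have s1 : u.1 ^+ 2 <= h ^+ 2 by rewrite -(real_normK (num_real u.1)) lerXn2r// nnegrE// ltW.
have s2 : u.2 ^+ 2 <= h ^+ 2 by rewrite -(real_normK (num_real u.2)) lerXn2r// nnegrE// ltW.
have h2 : 0 < h ^+ 2 by rewrite exprn_gt0.
rewrite /norm2 -[2 * h]ger0_norm; last by lra.
rewrite -sqrtr_sqr ltr_sqrt ?exprn_gt0 ?mulr_gt0// exprMn.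
by lra.
Qed.

(** Zero density leaves at most h^r points in every large ball of radius h. Used as the multiplicity
    bound against the mass 3^N / 2, this gives 3^N <= c (A2^N)^r for arbitrarily large N, impossible
    when A2^r < 3. *)
Lemma density_lower (L : set P2) (p : nat) (C r : R) : spectrum mu L -> (1 <= p)%N -> 0 < C ->
  (forall l, L l -> exists2 g, L g & norm2 (sub2 (Ainv p l) g) <= C) ->
  0 < r -> upper_density r L = 0%E -> sdim R q2 <= r.
Proof.
move=> sL p1 C0 hL r0 ud0; have [oL _] := sL.
have [M hM] : exists M, forall h x, M < h -> (card_e (L `&` ball2 x h) <= (h `^ r)%:E)%E.
  have : (upper_density r L < 1)%E by rewrite ud0.
  move=> /ereal_inf_lt[_ [M _ <-] hlt]; exists (Num.max 0 M) => h x.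
  rewrite gt_max => /andP[h0 Mh].
  have hr : 0 < h `^ r by rewrite powR_gt0.
  have : (card_e (L `&` ball2 x h) * ((h `^ r)^-1)%:E <= 1)%E.
    apply: le_trans (ltW hlt); apply: le_trans (ereal_sup_ubound _); last by exists h.
    by apply: ereal_sup_ubound; exists x.
  move=> k; have : (card_e (L `&` ball2 x h) * ((h `^ r)^-1)%:E * (h `^ r)%:E <= 1 * (h `^ r)%:E)%E.
    by apply: lee_wpmul2r => //; rewrite lee_fin ltW.
  by rewrite -muleA -EFinM mulVf ?gt_eqF// mule1 mul1e.
have A20 := A2_gt0 R hq2; have A23 := A2_ge3 R hq2.
pose E := expR (4 * pi * (2 * C)).
have E0 : 0 < E by exact: expR_gt0.
(* 8 is the factor 4 of [fourier2_cluster], doubled because only half of the mass is kept; 4 C A2^N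
   is the radius of the balls that hold the fibres. *)
pose c := 8 * E ^+ 2 * (4 * C) `^ r.
have c0 : 0 <= c by rewrite mulr_ge0 ?powR_ge0// mulr_ge0// sqr_ge0.
have bound n : M < 4 * C * A2 ^+ (p * n) -> 3 ^+ (p * n) <= c * (A2 ^+ (p * n)) `^ r.
  set N := (p * n)%N => hn.
  have aN : 0 < A2 ^+ N by rewrite exprn_gt0.
  have [t [ut tL ht]] := spectrum_mass N sL.
  have extau l : exists g, L l -> L g /\ (`|(sub2 (Ainv N l) g).1| <= 2 * C /\
      `|(sub2 (Ainv N l) g).2| <= 2 * C).
    have [Ll|nLl] := pselect (L l); last by exists l.
    by have [g Lg hg] := near_iterate p1 (ltW C0) hL n Ll; exists g.
  have [tau htau] := choice extau.
  (* The fibre over [gamma] lies around A^N gamma: multiplying back by A^N turns the bound 2 C into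
     2 C A2^N in both coordinates, as q1 <= q2, and [norm2_lt] doubles it. *)
  have hK gamma : (count (fun l => tau l == gamma) t)%:R <= (4 * C * A2 ^+ N) `^ r.
    rewrite -size_filter; apply: size_le_card_e (hM _ (matApow q1 q2 N gamma) hn) _ _.
      exact: filter_uniq.
    move=> l; rewrite mem_filter => /andP[/eqP tg lt].
    have [Lg [g1 g2]] := htau l (tL l lt); split; first exact: tL.
    rewrite tg in g1 g2; rewrite /ball2 /=.
    have -> : 4 * C * A2 ^+ N = 2 * (2 * C * A2 ^+ N) by ring.
    have key (a u w : R) : 0 < a -> a <= A2 -> `|u / a ^+ N - w| <= 2 * C ->
        `|u - a ^+ N * w| <= 2 * C * A2 ^+ N.
      move=> a0 aA h; have aN0 : 0 < a ^+ N by rewrite exprn_gt0.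
      have -> : u - a ^+ N * w = (u / a ^+ N - w) * a ^+ N by field; rewrite gt_eqF.
      rewrite normrM (gtr0_norm aN0); apply: ler_pM => //; first exact: ltW.
      by rewrite lerXn2r// nnegrE ltW.
    apply: norm2_lt => /=.
    - by rewrite !mulr_gt0.
    - apply: key => //; first exact: A1_gt0.
      by rewrite ler_pM2l// ler_nat.
    - by apply: key.
  pose z l := sub2 (Ainv N l) (tau l).
  have := @fourier2_cluster R mu (2 * C) ((4 * C * A2 ^+ N) `^ r) t tau z _
    (ae_Q hmu hq1 hq2) _ _ hK.
  rewrite -/E (_ : \sum_(l <- t) _ = \sum_(l <- t) fourier2 mu (Ainv N l)); last first.
    apply: eq_bigr => l _; congr (fourier2 mu _); rewrite /z /sub2 /=.
    by rewrite /matA_invpow; congr pair; ring.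
  move=> fc; have {}fc : \sum_(l <- t) fourier2 mu (Ainv N l) <=
      4 * E ^+ 2 * (4 * C * A2 ^+ N) `^ r.
    apply: fc; first by lra.
    - by move=> l lt; exact: (htau l (tL l lt)).2.
    - move=> g s bg us st; apply: (bessel_coef2 oL bg us) => g' /st /mapP[l lt ->].
      exact: (htau l (tL l lt)).1.
  rewrite powRM in fc; [|by lra|exact: ltW].
  rewrite /c; move: fc ht; move: (_ `^ r) => X; move: (_ `^ r) => Y; lra.
rewrite leNgt; apply/negP => rs.
have lA := lnA2_gt0 R hq2.
(* Since 3 = A2^sdim, r < sdim means th > 1, and by Bernoulli the powers of [th] outgrow [c]. *)
pose th := 3 / A2 `^ r.
have Ar : 0 < A2 `^ r by rewrite powR_gt0.
have th1 : 1 < th.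
  rewrite /th ltr_pdivlMr// mul1r -[ltRHS](A2_powR_sdim R hq2).
  by rewrite /powR gt_eqF// ltr_expR ltr_pM2r.
have [k hk] : exists k, c < k%:R * (th - 1).
  exists (Num.truncn (c / (th - 1))).+1.
  by rewrite -ltr_pdivrMr ?subr_gt0//; exact: truncnS_gt.
have [m hm] : exists m, M < m%:R * (4 * C).
  exists (Num.truncn (M / (4 * C))).+1.
  by rewrite -ltr_pdivrMr ?mulr_gt0//; exact: truncnS_gt.
(* [k] beats the constant [c], and [m] brings the radius above [M]. *)
pose n := (k + m)%N.
have np : (n <= p * n)%N by rewrite leq_pmull.
have hn : M < 4 * C * A2 ^+ (p * n).
  apply: (lt_le_trans hm); rewrite mulrC ler_pM2l ?mulr_gt0//.
  apply: (@le_trans _ _ (3 ^+ (p * n))); last by rewrite lerXn2r// nnegrE ltW.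
  rewrite -natrX ler_nat; apply: (@leq_trans (p * n)%N); last by rewrite ltnW// ltn_expl.
  by apply: leq_trans np; exact: leq_addl.
have := bound n hn; rewrite leNgt => /negP; apply.
have -> : (A2 ^+ (p * n)) `^ r = (A2 `^ r) ^+ (p * n).
  by rewrite -(powR_mulrn _ (ltW A20)) -powRrM (mulrC _ r) powRrM powR_mulrn//.
rewrite -ltr_pdivlMr ?exprn_gt0// -expr_div_n -/th.
apply: (lt_le_trans hk); apply: (@le_trans _ _ ((p * n)%:R * (th - 1))).
  rewrite ler_pM2r ?subr_gt0// ler_nat; apply: leq_trans np; exact: leq_addr.
have bern j : 1 + j%:R * (th - 1) <= th ^+ j.
  elim: j => [|j IH]; first by rewrite mul0r addr0 expr0.
  rewrite exprS -natr1 mulrDl mul1r.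
  have : th * (1 + j%:R * (th - 1)) <= th * th ^+ j by rewrite ler_pM2l//; lra.
  have : 0 <= j%:R * (th - 1) ^+ 2 by rewrite mulr_ge0// sqr_ge0.
  have -> : th * (1 + j%:R * (th - 1)) = 1 + (j%:R * (th - 1) + (th - 1)) + j%:R * (th - 1) ^+ 2.
    by ring.
  by lra.
by have := bern (p * n)%N; lra.
Qed.

Lemma beurling_dim_ge (L : set P2) (p : nat) : spectrum mu L -> (1 <= p)%N ->
  (ereal_sup [set ereal_inf [set (norm2 (sub2 (Ainv p l) g))%:E | g in L] | l in L] < +oo)%E ->
  ((sdim R q2)%:E <= beurling_dim L)%E.
Proof.
move=> sL p1 hsup.
have [C C0 hC] : exists2 C : R, 0 < C &
    forall l, L l -> exists2 g, L g & norm2 (sub2 (Ainv p l) g) <= C.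
  have [S hS] : exists S : R, (ereal_sup [set ereal_inf
      [set (norm2 (sub2 (Ainv p l) g))%:E | g in L] | l in L] <= S%:E)%E.
    (* The value -oo is that of an empty L. *)
    move: hsup; case: (ereal_sup _) => [S _|//|_]; first by exists S.
    by exists 0; exact: leNye.
  (* The infimum over [g] need not be attained, so the bound is raised by 1; the absolute value
     keeps it positive. *)
  exists (`|S| + 1); first by rewrite ltr_wpDl.
  move=> l Ll.
  have : (ereal_inf [set (norm2 (sub2 (Ainv p l) g))%:E | g in L] < (`|S| + 1)%:E)%E.
    apply: (@le_lt_trans _ _ S%:E); last first.
      by rewrite lte_fin; apply: le_lt_trans (ler_norm S) _; rewrite ltrDl.
    by apply: le_trans hS; apply: ereal_sup_ubound; exists l.
  by move=> /ereal_inf_lt[_ [g Lg <-]]; rewrite lte_fin => /ltW; exists g.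
apply: le_ereal_inf_tmp => _ [r [r0 ud] <-]; rewrite lee_fin.
exact: density_lower sL p1 C0 hC r0 ud.
Qed.

End Spectra.

Theorem theorem1p3 (R : realType) (q1 q2 : nat)
  (hq1 : (1 <= q1)%N) (hq12 : (q1 <= q2)%N)
  (mu : probability (R * R)%type R)
  (hmu : sierpinski_invariant q1 q2 mu) :
  (forall L : set (R * R)%type, orthogonal_set mu L ->
     (beurling_dim L <= (ln 3 / ln (3 * q2%:R))%:E)%E) /\
  (forall L : set (R * R)%type, spectrum mu L ->
     forall p : nat, (1 <= p)%N ->
     (ereal_sup [set ereal_inf
        [set (norm2 ((matA_invpow q1 q2 p l).1 - g.1,
                     (matA_invpow q1 q2 p l).2 - g.2))%:E | g in L]
        | l in L] < +oo)%E ->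
     beurling_dim L = (ln 3 / ln (3 * q2%:R))%:E).
Proof.
have hq2 := leq_trans hq1 hq12.
split=> [L oL|L sL p p1 hsup]; first exact: (beurling_dim_le hq1 hq2 hmu oL).
apply/eqP; rewrite eq_le; apply/andP; split.
  exact: (beurling_dim_le hq1 hq2 hmu sL.1).
exact: (beurling_dim_ge hq1 hq12 hmu sL p1 hsup).
Qed.
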